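(* Consider two $M^{X}/G/1$ queues operating under the LCFS-p-resume discipline, with the same Poisson batch-arrival rate $\lambda$ and the same batch-size distribution (mean $\mu$), and with generic i.i.d. service times $S$ and $S'$ respectively, both stable ($\lambda\mu ES<1$, $\lambda\mu ES'<1$). Let $M$ and $M'$ be the maximum numbers of customers in the system during a busy period in the respective queues. If $S'\leq_{LT}S$, then $M'\leq_{st}M$. In particular, if $S'\geq_{cx}S$, then $M'\leq_{st}M$.
   Context: Under LCFS-p-resume, the customer who has been in the system the least amount of time is always served, newly arriving customers preempt the customer in service, customers within a batch are labeled arbitrarily (treated as arriving sequentially), service is non-idling, and preempted customers resume service where they left off. Orders: $X\geq_{st}Y$ iff $P(X>t)\geq P(Y>t)$ for all $t$; $X\geq_{cx}Y$ iff $E\phi(X)\geq E\phi(Y)$ for all convex $\phi$ for which the expectations exist; $X\geq_{LT}Y$ iff $E[e^{-\theta X}]\leq E[e^{-\theta Y}]$ for all $\theta>0$ for which the expectations exist. *)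

(* Defs.v *)
From HB Require Import structures.
From mathcomp Require Import all_boot all_order all_algebra.
From mathcomp Require Import all_classical all_reals all_analysis.
From Stdlib Require List.
Set Implicit Arguments. Unset Strict Implicit. Unset Printing Implicit Defensive.
Import Order.TTheory GRing.Theory Num.Theory.
Local Open Scope classical_set_scope.
Local Open Scope ring_scope.

(* Sample-path dynamics of a busy period of an M^X/G/1 queue under      *)
(* LCFS-p-resume.                                                      *)
(*   a i   : i-th interarrival time; batch 0 arrives at time 0 to an   *)
(*           empty system (start of the busy period), batch k >= 1      *)
(*           arrives at time a 0 + ... + a (k-1).                      *)
(*   b k   : size of batch k.                                          *)
(*   s k j : service time of the j-th customer (j < b k) of batch k.   *)
(* Customers within a batch are treated as arriving sequentially in    *)
(* the order j = 0, 1, ..., b k - 1, so customer b k - 1 is served     *)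
(* first.  The state is (current time, index of next batch, stack of   *)
(* remaining service requirements of customers in system, the head     *)
(* being the customer in service = the one who has been in the system  *)
(* the least time).  The number of customers in system is the size of  *)
(* the stack.                                                          *)

Definition lcfs_state (R : realType) := (R * nat * seq R)%type.

Definition arrival_time (R : realType) (a : nat -> R) (k : nat) : R :=
  \sum_(i < k) a i.

Definition batch_stack (R : realType) (b : nat -> nat) (s : nat -> nat -> R)
  (k : nat) : seq R := rev [seq s k j | j <- iota 0 (b k)].

(* one event: either the customer in service completes (before or at   *)
(* the next arrival), or the next batch arrives and preempts it (its   *)
(* remaining service is kept: preemptive resume).  An empty system     *)
(* (end of the busy period) is absorbing.                              *)
Definition lcfs_step (R : realType) (a : nat -> R) (b : nat -> nat)
  (s : nat -> nat -> R) (st : lcfs_state R) : lcfs_state R :=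
  let: (t, k, stk) := st in
  match stk with
  | [::] => st
  | r :: rest =>
      let Tk := arrival_time a k in
      if t + r <= Tk then (t + r, k, rest)
      else (Tk, k.+1, batch_stack b s k ++ ((r - (Tk - t)) :: rest))
  end.

Definition lcfs_init (R : realType) (b : nat -> nat) (s : nat -> nat -> R)
  : lcfs_state R := (0, 1%N, batch_stack b s 0).

Definition lcfs_num (R : realType) (a : nat -> R) (b : nat -> nat)
  (s : nat -> nat -> R) (n : nat) : nat :=
  size (iter n (lcfs_step a b s) (lcfs_init b s)).2.

Definition lcfs_max_busy (R : realType) (a : nat -> R) (b : nat -> nat)
  (s : nat -> nat -> R) : \bar R :=
  ereal_sup (range (fun n => ((lcfs_num a b s n)%:R : R)%:E)).

Inductive qidx := IA of nat | IB of nat | IS of nat & nat.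

Definition mutually_independent d (T : measurableType d) (R : realType)
  (P : probability T R) (I : Type) (X : I -> {RV P >-> R}) : Prop :=
  forall (J : seq I) (E : I -> set R),
    (forall i, List.In i J -> measurable (E i)) -> List.NoDup J ->
    P (\bigcap_(i in [set i | List.In i J]) (X i @^-1` E i)) =
    (\prod_(i <- J) P (X i @^-1` E i))%E.
Arguments mutually_independent {d T R} P {I} X.

Definition MX_G_1_inputs d (T : measurableType d) (R : realType)
  (P : probability T R) (lam : R) (p : nat -> R)
  (A : nat -> {RV P >-> R}) (B : nat -> {RV P >-> R})
  (S : nat -> nat -> {RV P >-> R}) : Prop :=
  [/\ mutually_independent P
        (fun i => match i with IA n => A n | IB n => B n | IS k j => S k j end),
      (forall i (t : R), 0 <= t -> P [set w | t < A i w] = (expR (- (lam * t)))%:E),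
      (forall k (n : nat), P [set w | B k w = n%:R] = (p n)%:E),
      (forall k j (E : set R), measurable E ->
          P (S k j @^-1` E) = P (S 0%N 0%N @^-1` E)) &
      P [set w | S 0%N 0%N w < 0] = 0%E].

Definition max_busy d (T : measurableType d) (R : realType)
  (P : probability T R) (A : nat -> {RV P >-> R}) (B : nat -> {RV P >-> R})
  (S : nat -> nat -> {RV P >-> R}) (w : T) : \bar R :=
  lcfs_max_busy (fun i => A i w) (fun k => Num.truncn (B k w))
    (fun k j => S k j w).

Definition convex_fun (R : realType) (phi : R -> R) : Prop :=
  forall (x y t : R), 0 <= t <= 1 ->
    phi (t * x + (1 - t) * y) <= t * phi x + (1 - t) * phi y.

Arguments MX_G_1_inputs {d T R} P lam p A B S.

(* Main.v *)
(* Observe the system at arrival epochs. Suppose that a busy period fails as   *)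

(* Under preemptive resume, a customer is interrupted at rate [lam] along its service, each time by
   a fresh batch that must be cleared above it. Every interruption is survived independently with
   the same probability [g], so by Poisson thinning a service [r] survives with probability exp(-
   lam (1 - g) r). Service laws therefore enter only through Laplace transforms: larger transforms
   raise the clearing probabilities, which lowers the exponents, which raises the transforms
   evaluated there ([batch_value_rates_le]).

   The proof does not decompose paths into sub-busy periods. The recursion is taken as the
   definition of [rates] and [batch_value], and [value] is shown to be harmonic for the stack
   observed at arrivals: [integral_drain_value] averages over the interarrival time,
   [integral_value_batch] over the batch, and [integral_next] provides the independence. The
   resulting martingale [integral_bounded_value] gives the lower bound [le_prob_bounded_forall];
   stability, through the drift inequality [load_step], gives the upper bound
   [prob_bounded_forall_le]. The link with the maximum over all events is [lt_lcfs_max_busy]. The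
   convex order reduces to the Laplace order because exponentials are convex. *)
(* soon as more than [n] customers are present. By preemption, a customer with *)
(* [i] customers below and service time [r] is served without failure with     *)
(* probability [exp (- theta_i r)], where [theta_i = lam (1 - g_(i+1))] and     *)
(* [g_j] is the probability that a batch arriving on top of [j] customers is   *)
(* cleared without failure; [g_j] is a polynomial with nonnegative coefficients*)
(* in the Laplace transforms of [S] at [theta_j, theta_(j+1), ...]. Hence, by   *)
(* backward induction on [j], every [g_j] increases with the Laplace transform *)
(* of [S], and [g_0] turns out to be P(M <= n).                                *)
(*   The product of the factors [exp (- theta_i r_i)] over the stack, stopped  *)
(* at failure, is a martingale with mean [g_0], bounded by the indicator of    *)
(* non-failure: this gives g_0 <= P(M <= n). For the converse it suffices that *)
(* the probability of a long busy period without failure vanishes; the total   *)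
(* work in the system is a Lyapunov function for that, by stability.           *)
Require Import Defs.
From HB Require Import structures.
From mathcomp Require Import all_boot all_order all_algebra.
From mathcomp Require Import all_classical all_reals all_analysis.
From mathcomp Require Import measurable_realfun ring.
From Stdlib Require List.
Set Implicit Arguments. Unset Strict Implicit. Unset Printing Implicit Defensive.
Import Order.TTheory GRing.Theory Num.Theory.
Import numFieldNormedType.Exports.
Local Open Scope classical_set_scope.
Local Open Scope ring_scope.

(** * Independent sigma-algebras *)

Section independence.
Context d (T : measurableType d) (R : realType) (P : probability T R).
Context (I : Type) (X : I -> {RV P >-> R}).

Definition cylinder (s : seq I) (E : I -> set R) : set T :=
  \bigcap_(i in [set i | List.In i s]) X i @^-1` E i.

Definition cylinders (J : set I) : set (set T) :=
  [set C | exists s E, [/\ List.NoDup s, forall i, List.In i s -> J i,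
     forall i, measurable (E i) & C = cylinder s E]].

Local Notation sigma J := (g_sigma_algebraType (cylinders J)).

Lemma cylinders_measurable J : cylinders J `<=` measurable.
Proof.
move=> _ [s [E [_ _ mE ->]]]; apply: fin_bigcap_measurable.
  elim: s => [|i s IH]; first by rewrite (_ : [set _ | _] = set0)// -subset0.
  rewrite (_ : [set _ | _] = [set i] `|` [set j | List.In j s]).
    by rewrite finite_setU; split.
  by apply/seteqP; split=> j /= [->|?]; by [left|right].
by move=> i _; rewrite -[X in measurable X]setTI; exact: measurable_funP.
Qed.

Lemma cylinders_setT J : cylinders J setT.
Proof.
exists [::], (fun=> setT); split=> //; first exact: List.NoDup_nil.
by rewrite /cylinder (_ : [set _ | _] = set0) ?bigcap_set0// -subset0.
Qed.

(** The two index lists may overlap: they are merged without duplicates, each index carrying [setT]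
    on the side that does not list it. *)
Lemma cylinders_setI J : setI_closed (cylinders J).
Proof.
move=> _ _ [s [E [ns sJ mE ->]]] [t [F [nt tJ mF ->]]].
pose dec (x y : I) : {x = y} + {x <> y} := pselect (x = y).
exists (List.nodup dec (List.app s t)), (fun i =>
  (if pselect (List.In i s) then E i else setT) `&`
  (if pselect (List.In i t) then F i else setT)); split.
- exact: List.NoDup_nodup.
- by move=> i /List.nodup_In /List.in_app_iff[/sJ|/tJ].
- move=> i; have mite Q (A : set R) : measurable A ->
      measurable (if pselect Q then A else setT).
    by case: (pselect Q) => ? ?//=; exact: measurableT.
  exact: measurableI (mite _ _ (mE i)) (mite _ _ (mF i)).
- apply/seteqP; split => w.
    move=> [ws wt] i /= /List.nodup_In /List.in_app_iff ist.
    split; case: pselect => //= it; first exact: ws it.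
    exact: wt it.
  move=> wst; split=> i /= ist.
    have /wst[]/= : [set i | List.In i (List.nodup dec (List.app s t))] i.
      by apply/List.nodup_In/List.in_app_iff; left.
    by case: pselect => //=.
  have /wst[]/= : [set i | List.In i (List.nodup dec (List.app s t))] i.
    by apply/List.nodup_In/List.in_app_iff; right.
  by move=> _; case: pselect.
Qed.

Lemma sigma_measurable J A : (<<s cylinders J >>) A -> measurable A.
Proof.
exact: (smallest_sub (@sigma_algebra_measurable _ T) (@cylinders_measurable J)).
Qed.

Lemma measurable_sigma_id J : measurable_fun setT (id : T -> sigma J).
Proof. by move=> _ A mA; rewrite setTI; exact: (@sigma_measurable J). Qed.

Lemma measurable_sigma_var J i : J i ->
  measurable_fun setT (X i : sigma J -> R).
Proof.
move=> Ji _ A mA; rewrite setTI; apply: sub_sigma_algebra.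
exists [:: i], (fun=> A); split=> //.
- by apply: List.NoDup_cons => //; exact: List.NoDup_nil.
- by move=> j [<-|].
- apply/seteqP; split => [w ? j [<-//|//]|w /(_ i)]; apply; exact: or_introl.
Qed.

Hypothesis indX : mutually_independent P X.

Lemma cylinder_prob s E : List.NoDup s -> (forall i, measurable (E i)) ->
  P (cylinder s E) = (\prod_(i <- s) P (X i @^-1` E i))%E.
Proof. by move=> ns mE; apply: indX. Qed.

Variables J K : set I.
Hypothesis JK : forall i, J i -> K i -> False.

(** As [J] and [K] are disjoint, both families of sets glue to one family [G] over the concatenated
    list, where mutual independence applies directly. *)
Lemma independent_cylinders A B : cylinders J A -> cylinders K B ->
  P (A `&` B) = (P A * P B)%E.
Proof.
move=> [s [E [ns sJ mE ->]]] [t [F [nt tK mF ->]]].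
pose G i := if pselect (J i) then E i else F i.
have GE i : List.In i s -> G i = E i by move=> /sJ; rewrite /G; case: pselect.
have GF i : List.In i t -> G i = F i.
  by move=> /tK Ki; rewrite /G; case: pselect => // Ji; case: (JK Ji Ki).
have mG i : measurable (G i) by rewrite /G; case: pselect => /= ?.
have -> : cylinder s E `&` cylinder t F = cylinder (List.app s t) G.
  apply/seteqP; split => [w [ws wt] i /= /List.in_app_iff[|] it|w wst].
  - by rewrite GE//; exact: ws.
  - by rewrite GF//; exact: wt.
  - split=> i /= it.
      by rewrite -GE//; apply: wst; apply/List.in_app_iff; left.
    by rewrite -GF//; apply: wst; apply/List.in_app_iff; right.
rewrite !cylinder_prob//; last first.
  apply: List.NoDup_app => // i /sJ Ji /tK; exact: JK.
have prodE (u : seq I) (H H' : I -> set R) :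
    (forall i, List.In i u -> H i = H' i) ->
    (\prod_(i <- u) P (X i @^-1` H i) = \prod_(i <- u) P (X i @^-1` H' i))%E.
  elim: u => [|i u IH] HH; first by rewrite !big_nil.
  rewrite !big_cons HH; last by left.
  by rewrite IH// => j ju; apply: HH; right.
rewrite -[List.app s t]/(s ++ t) big_cat/=.
by rewrite (prodE s _ _ GE) (prodE t _ _ GF).
Qed.

(** Measure uniqueness on a pi-system, used for one factor at a time: for a fixed event, [P]
    restricted to it and [P] scaled by its probability agree on cylinders. *)
Lemma independent_sigma A B : (<<s cylinders J >>) A -> (<<s cylinders K >>) B ->
  P (A `&` B) = (P A * P B)%E.
Proof.
have step J' A' (mA' : measurable A') :
    (forall B, cylinders J' B -> P (A' `&` B) = P A' * P B)%E ->
    forall B, (<<s cylinders J' >>) B -> (P (A' `&` B) = P A' * P B)%E.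
  move=> h B' sB'.
  have [k PA] : exists k : {nonneg R}, P A' = (k%:num)%:E.
    have f0 : 0 <= fine (P A') by exact: fine_ge0.
    by exists (NngNum f0); rewrite /= fineK// fin_num_measure.
  rewrite setIC PA.
  apply: (g_sigma_algebra_measure_unique (cylinders J') (@cylinders_measurable J')
    (fun=> setT) _ _ (mrestr P mA') (mscale k P)) => //.
  - by move=> _; exact: cylinders_setT.
  - by rewrite bigcup_const//; exists 0%N.
  - exact: cylinders_setI.
  - by move=> C GC; rewrite /= /mrestr setIC h// /mscale/= PA.
  - move=> _; rewrite /= /mrestr setTI.
    by rewrite (le_lt_trans (probability_le1 P mA'))// ltry.
move=> sA sB; apply: (step _ _ _ _ _ sB); first exact: (@sigma_measurable J).
move=> C GC; rewrite setIC muleC; apply: (step _ _ _ _ _ sA).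
  exact: (@cylinders_measurable K).
by move=> D GD; rewrite setIC muleC; exact: independent_cylinders.
Qed.

(* The diagonal map pushes [P] forward to the product of its restrictions to *)
(* the two independent sigma-algebras; then Fubini-Tonelli applies.          *)

Lemma integral_diagonal (f : sigma J * sigma K -> \bar R) :
  measurable_fun setT f ->
  (forall z, 0 <= f z)%E ->
  (\int[P]_w f (w, w) = \int[P]_w \int[P]_w' f (w, w'))%E.
Proof.
move=> mf f0.
pose dg : T -> (sigma J * sigma K)%type := fun w => (w, w).
have mdg : measurable_fun setT dg.
  by apply: measurable_fun_pair; exact: measurable_sigma_id.
pose P1 := distribution P (mfun_Sub (mem_set (@measurable_sigma_id J)) : {mfun T >-> sigma J}).
pose P2 := distribution P (mfun_Sub (mem_set (@measurable_sigma_id K)) : {mfun T >-> sigma K}).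
pose m : {measure set (sigma J * sigma K) -> \bar R} :=
  distribution P (mfun_Sub (mem_set mdg) : {mfun T >-> (sigma J * sigma K)%type}).
have mE : forall C, measurable C -> (P1 \x P2)%E C = m C.
  apply: product_measure_unique => A B mA mB.
  exact: (independent_sigma mA mB).
have fJ w : measurable_fun setT (fun w' : sigma K => f (w, w')).
  exact: measurable_fun_pair2.
transitivity (\int[m]_z f z)%E.
  by rewrite ge0_integral_distribution.
rewrite (eq_measure_integral (P1 \x P2)%E); last by move=> A mA _; rewrite -?mE//; exact/esym/mE.
rewrite fubini_tonelli1// ge0_integral_distribution//; last 2 first.
- exact: measurable_fun_fubini_tonelli_F.
- by move=> w; apply: integral_ge0.
by apply: eq_integral => w _; rewrite /= /fubini_F ge0_integral_distribution.
Qed.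

End independence.

(** * The stack at arrival epochs *)

Section embedded_chain.
Context (R : realType).
Implicit Types (q u v : seq R) (x : R).

(** A completion exactly at time [x] counts as done, in agreement with the tie rule of
    [lcfs_step]. *)
Fixpoint drain q x : seq R :=
  if q is r :: q' then
    if r <= x then drain q' (x - r) else (r - x) :: q'
  else [::].

(** A batch that finds the system empty belongs to another busy period and is discarded, so the
    empty stack is absorbing. *)
Definition arrive q x u : seq R :=
  if drain q x is [::] then [::] else u ++ drain q x.

Variables (a : nat -> R) (b : nat -> nat) (s : nat -> nat -> R).

(* The stack just after the arrival of batch [k], empty if the busy period *)
(* has ended by then.                                                      *)
Fixpoint stack_at k : seq R :=
  if k is k'.+1 then arrive (stack_at k') (a k') (batch_stack b s k)
  else batch_stack b s 0.

Local Notation step := (lcfs_step a b s).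
Local Notation state m := (iter m step (lcfs_init b s)).

Lemma arrival_timeS k : arrival_time a k.+1 = arrival_time a k + a k.
Proof. by rewrite /arrival_time big_ord_recr. Qed.

Lemma arrival_time_diff k : arrival_time a k.+1 - arrival_time a k = a k.
Proof. by rewrite arrival_timeS addrC addKr. Qed.

(** Completions only shrink the stack between arrivals, and what will be left at the next arrival
    does not depend on how many of them have been processed; this last equation carries the
    induction across an arrival. *)
Lemma state_invariant m : exists k, exists t, exists q,
  [/\ state m = (t, k.+1, q), (size q <= size (stack_at k))%N &
      drain (stack_at k) (a k) = drain q (arrival_time a k.+1 - t)].
Proof.
elim: m => [|m [k [t [q [mE sq dq]]]]].
  exists 0%N, 0, (batch_stack b s 0); split=> //=.
  by rewrite subr0 /arrival_time big_ord1.
rewrite iterS mE; case: q => [|r q] /= in sq dq {mE} *.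
  by exists k, t, [::].
rewrite lerBrDl in dq; case: ifPn dq => [tr|/negbTE tr] dq.
  by exists k, (t + r), q; rewrite opprD addrA (ltnW sq).
exists k.+1, (arrival_time a k.+1); do 1!eexists; split; first by [].
  by rewrite /= /arrive dq.
by rewrite arrival_time_diff /= /arrive dq.
Qed.

Lemma state_reaches_arrival k t q :
  drain q (arrival_time a k.+1 - t) != [::] ->
  exists m, iter m step (t, k.+1, q) = (arrival_time a k.+1, k.+2,
    batch_stack b s k.+1 ++ drain q (arrival_time a k.+1 - t)).
Proof.
elim: q t => [//|r q IH] t /=; rewrite lerBrDl.
case: ifPn => [tr|/negbTE tr _].
  rewrite -addrA -opprD => /IH[m mE]; exists m.+1.
  by rewrite iterSr /= tr mE.
by exists 1%N; rewrite /= tr.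
Qed.

Lemma stack_at_reached k : stack_at k != [::] ->
  exists m, state m = (arrival_time a k, k.+1, stack_at k).
Proof.
elim: k => [_|k IH].
  by exists 0%N; rewrite /arrival_time big_ord0.
rewrite /= /arrive; case: (boolP (stack_at k == [::])) => [/eqP ->//|/IH[m mE]].
case: (boolP (drain (stack_at k) (a k) == [::])) => [/eqP ->//|dn _].
have aE := esym (arrival_time_diff k).
have [m' m'E] := @state_reaches_arrival k (arrival_time a k) (stack_at k)
  ltac:(by rewrite -aE).
by exists (m' + m)%N; rewrite iterD mE m'E -aE; case: drain dn.
Qed.

(** The number in system rises only at arrivals, so observing the stack there loses nothing of the
    supremum. *)
Lemma lt_lcfs_max_busy (t : R) :
  (t%:E < lcfs_max_busy a b s)%E <-> exists k, t < (size (stack_at k))%:R.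
Proof.
split=> [/ereal_sup_gt[_ [m _ <-]]|[k tk]].
  rewrite lte_fin /lcfs_num; have [k [t' [q [-> /= qk _]]]] := state_invariant m.
  by move=> tq; exists k; rewrite (lt_le_trans tq)// ler_nat.
apply/ereal_sup_gtP.
have [k0|/stack_at_reached[m mE]] := eqVneq (stack_at k) [::].
  (* Here [t] is negative, so any event is a witness. *)
  exists ((lcfs_num a b s 0)%:R%:E); first by exists 0%N.
  by rewrite lte_fin (lt_le_trans tk)// k0.
exists ((lcfs_num a b s m)%:R%:E); first by exists m.
by rewrite lte_fin /lcfs_num mE.
Qed.

End embedded_chain.

(** * Measurability of list-valued maps *)

Section measurable_seq.
Context d (U : measurableType d) (R : realType).

Lemma measurable_fun_nat (N : U -> nat) :
  (forall n, measurable (N @^-1` [set n])) -> measurable_fun setT N.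
Proof.
move=> mN _ Y _; rewrite setTI.
rewrite (_ : N @^-1` Y = \bigcup_(n in Y) (N @^-1` [set n])).
  by apply: bigcup_measurable => n _; exact: mN.
by apply/seteqP; split=> [w Yw|w [n Yn /= ->//]]; exists (N w).
Qed.

Lemma measurable_fun_nat_comp d' (V : measurableType d') (N : U -> nat)
    (g : nat -> U -> V) :
  measurable_fun setT N -> (forall n, measurable_fun setT (g n)) ->
  measurable_fun setT (fun w => g (N w) w).
Proof.
move=> mN mg _ Y mY; rewrite setTI.
rewrite (_ : _ @^-1` Y =
    \bigcup_n (N @^-1` [set n] `&` g n @^-1` Y)).
  apply: bigcupT_measurable => n; apply: measurableI.
    by rewrite -[X in measurable X]setTI; exact: mN.
  by rewrite -[X in measurable X]setTI; exact: mg.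
by apply/seteqP; split=> [w /= Yw|w [n _ [/= ->//]]]; exists (N w).
Qed.

(** Countably many scalar conditions stand for a sigma-algebra on lists; the default 0 makes every
    coordinate a total function. *)
Definition measurable_seq (f : U -> seq R) :=
  measurable_fun setT (fun w => size (f w)) /\
  forall i, measurable_fun setT (fun w => nth 0 (f w) i).

Lemma measurable_seq_cst (q : seq R) : measurable_seq (fun=> q).
Proof. by split. Qed.

Lemma measurable_seq_mkseq (f : nat -> U -> R) n :
  (forall i, measurable_fun setT (f i)) ->
  measurable_seq (fun w => mkseq (f^~ w) n).
Proof.
move=> mf; split=> [|i].
  by under eq_fun do rewrite size_mkseq; exact: measurable_cst.
have [ni|ni] := ltnP i n.
  by under eq_fun do rewrite nth_mkseq//; exact: mf.
under eq_fun do rewrite nth_default ?size_mkseq//; exact: measurable_cst.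
Qed.

Lemma measurable_seq_if (c : U -> bool) f g :
  measurable_fun setT c -> measurable_seq f -> measurable_seq g ->
  measurable_seq (fun w => if c w then f w else g w).
Proof.
move=> mc [sf nf] [sg ng]; split=> [|i].
  under eq_fun do rewrite (fun_if size).
  exact: measurable_fun_ifT.
under eq_fun do rewrite (fun_if (fun q => nth 0 q i)).
exact: measurable_fun_ifT.
Qed.

Lemma measurable_seq_cons x f : measurable_fun setT x -> measurable_seq f ->
  measurable_seq (fun w => x w :: f w).
Proof.
move=> mx [sf nf]; split=> [|[|i]] //=.
exact: (@measurableT_comp _ _ _ _ _ _ succn).
Qed.

Lemma measurable_seq_nat_comp (N : U -> nat) (g : nat -> U -> seq R) :
  measurable_fun setT N -> (forall n, measurable_seq (g n)) ->
  measurable_seq (fun w => g (N w) w).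
Proof.
move=> mN mg; split=> [|i].
  by apply: (measurable_fun_nat_comp (g := fun n w => size (g n w))) => // n; case: (mg n).
by apply: (measurable_fun_nat_comp (g := fun n w => nth 0 (g n w) i)) => // n; case: (mg n).
Qed.

(* Decomposing along the size reduces a function of [f w] to functions of *)
(* finitely many measurable real functions.                               *)
Lemma measurable_fun_seq_comp d' (V : measurableType d') (f : U -> seq R)
    (F : seq R -> U -> V) : measurable_seq f ->
  (forall n (x : nat -> U -> R), (forall i, measurable_fun setT (x i)) ->
    measurable_fun setT (fun w => F (mkseq (x^~ w) n) w)) ->
  measurable_fun setT (fun w => F (f w) w).
Proof.
move=> [sf nf] mF.
under eq_fun do rewrite -{1}(mkseq_nth 0 (f _)).
exact: (measurable_fun_nat_comp (g := fun n w => F (mkseq (nth 0 (f w)) n) w)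
  sf (fun n => mF n (fun i w => nth 0 (f w) i) nf)).
Qed.

Lemma measurable_seq_seq_comp (f : U -> seq R) (F : seq R -> U -> seq R) :
  measurable_seq f ->
  (forall n (x : nat -> U -> R), (forall i, measurable_fun setT (x i)) ->
    measurable_seq (fun w => F (mkseq (x^~ w) n) w)) ->
  measurable_seq (fun w => F (f w) w).
Proof.
move=> mf mF; split=> [|i].
  by apply: (measurable_fun_seq_comp (F := fun q w => size (F q w)) mf) => n x /(mF n)[].
by apply: (measurable_fun_seq_comp (F := fun q w => nth 0 (F q w) i) mf) => n x /(mF n)[].
Qed.

Lemma measurable_seq_cat f g : measurable_seq f -> measurable_seq g ->
  measurable_seq (fun w => f w ++ g w).
Proof.
move=> mf mg; apply: (measurable_seq_seq_comp (F := fun q w => q ++ g w)) => //.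
elim=> [//|n IH] x mx.
rewrite (_ : (fun w => _) =
  fun w => x 0%N w :: (mkseq (fun i => x i.+1 w) n ++ g w)).
  by apply: measurable_seq_cons => //; exact: IH.
apply/funext => w; rewrite /mkseq /= (iotaDl 1 0) -map_comp.
by congr (_ :: (_ ++ _)).
Qed.

Lemma measurable_seq_drain f x : measurable_seq f -> measurable_fun setT x ->
  measurable_seq (fun w => drain (f w) (x w)).
Proof.
move=> mf mx; apply: (measurable_seq_seq_comp (F := fun q w => drain q (x w))) => //.
move=> n; elim: n x mx => [|n IH] y my x mx; first exact: measurable_seq_cst.
rewrite (_ : (fun w => _) = fun w => if x 0%N w <= y w then
    drain (mkseq (fun i => x i.+1 w) n) (y w - x 0%N w)
  else (x 0%N w - y w) :: mkseq (fun i => x i.+1 w) n).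
  apply: measurable_seq_if; first exact: measurable_fun_ler.
    by apply: (IH (fun w => y w - x 0%N w)) => //; exact: measurable_funB.
  apply: measurable_seq_cons; first exact: measurable_funB.
  exact: measurable_seq_mkseq.
by apply/funext => w; rewrite /mkseq /= (iotaDl 1 0) -map_comp.
Qed.

Lemma measurable_seq_arrive f x g : measurable_seq f -> measurable_fun setT x ->
  measurable_seq g -> measurable_seq (fun w => arrive (f w) (x w) (g w)).
Proof.
move=> mf mx mg; have md := measurable_seq_drain mf mx.
rewrite (_ : (fun w => _) = fun w => if size (drain (f w) (x w)) == 0%N then [::]
   else g w ++ drain (f w) (x w)).
  apply: measurable_seq_if; last 2 first.
  - exact: measurable_seq_cst.
  - exact: measurable_seq_cat.
  exact: (measurable_fun_nat_comp (g := fun n _ => n == 0%N) md.1).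
by apply/funext => w; rewrite /arrive; case: drain.
Qed.

Lemma measurable_seq_batch (N : U -> nat) (s : nat -> nat -> U -> R) k :
  measurable_fun setT N -> (forall j, measurable_fun setT (s k j)) ->
  measurable_seq (fun w => batch_stack (fun=> N w) (fun i j => s i j w) k).
Proof.
move=> mN ms; apply: (measurable_seq_nat_comp
  (g := fun n w => batch_stack (fun=> n) (fun i j => s i j w) k) mN) => n.
rewrite /batch_stack (_ : (fun w => _) = fun w => mkseq
   (fun j => s k (n - j.+1)%N w) n).
  exact: (measurable_seq_mkseq (f := fun j => s k (n - j.+1)%N)).
apply/funext => w; apply: (@eq_from_nth _ 0).
  by rewrite size_rev size_map size_iota size_mkseq.
rewrite size_rev size_map size_iota => i ni.
rewrite nth_rev size_map size_iota// -/(mkseq (fun j => s k j w) n) !nth_mkseq//.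
by rewrite ltn_subrL (leq_ltn_trans _ ni).
Qed.

End measurable_seq.

(** * Values of stacks and exponents *)

Section value.
Context (R : realType).
Implicit Types (th q u v : seq R) (r : R).

(** The factor of a customer with [i] others below. A position outside [th] means that the capacity
    [size th] is exceeded: failure, hence 0. *)
Definition weight th i r : R :=
  if (i < size th)%N then expR (- (nth 0 th i * r)) else 0.

(** For [th] equal to [rates L n], to be thought of as the probability of emptying [q] without ever
    exceeding [n] customers. *)
Fixpoint value th q : R :=
  if q is r :: q' then weight th (size q') r * value th q' else 1.

Lemma weight_ge0 th i r : 0 <= weight th i r.
Proof. by rewrite /weight; case: ifP => // _; exact: expR_ge0. Qed.

Lemma value_ge0 th q : 0 <= value th q.
Proof. by elim: q => //= r q IH; rewrite mulr_ge0// weight_ge0. Qed.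

Lemma value_le1 th q : (forall i, 0 <= nth 0 th i) -> all (>= 0) q ->
  value th q <= 1.
Proof.
move=> th0; elim: q => //= r q IH /andP[r0 /IH q1].
rewrite mulr_ile1 ?weight_ge0 ?value_ge0// /weight; case: ifP => // _.
by rewrite -expR0 ler_expR oppr_le0 mulr_ge0.
Qed.

Lemma weight_drop th k i r : weight (drop k th) i r = weight th (k + i) r.
Proof. by rewrite /weight nth_drop size_drop ltn_subRL. Qed.

Lemma value_cat th u v :
  value th (u ++ v) = value (drop (size v) th) u * value th v.
Proof.
elim: u => [|r u IH] /=; first by rewrite mul1r.
by rewrite IH mulrA weight_drop size_cat addnC.
Qed.

(** The reversal in [batch_stack] puts customer [j] above exactly [j] customers of its own batch. *)
Lemma value_rev_map th (f : nat -> R) n :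
  value th (rev [seq f j | j <- iota 0 n]) = \prod_(j < n) weight th j (f j).
Proof.
elim: n => [|n IH]; first by rewrite big_ord0.
rewrite -addn1 iotaD map_cat rev_cat add0n /= addn1 big_ord_recr/= -IH.
by rewrite size_rev size_map size_iota mulrC.
Qed.

Lemma value_oversize th q : (size th < size q)%N -> value th q = 0.
Proof. by case: q => //= r q; rewrite ltnS /weight leqNgt => /negbTE ->; rewrite mul0r. Qed.

End value.

(** * Clearing probabilities, exponents and their monotonicity *)

Section rates.
Context (R : realType) (lam : R) (p : nat -> R).
Implicit Types (th : seq R) (L : R -> R).

(* The probability that a batch meeting [size th] free places, together with *)
(* the customers arriving until it has left, never exceeds them.             *)
Definition batch_value L th : R :=
  \sum_(m < (size th).+1) p m * \prod_(j < m) L (nth 0 th j).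

(* The [i]-th entry of [rates L n] is the exponent attached to a customer    *)
(* having [i] customers below, when at most [n] are allowed in the system.   *)
Fixpoint rates L n : seq R :=
  if n is n'.+1 then lam * (1 - batch_value L (rates L n')) :: rates L n'
  else [::].

Lemma size_rates L n : size (rates L n) = n.
Proof. by elim: n => //= n ->. Qed.

(** The tail of [rates] is again a list of rates: an exponent depends only on the number of places
    left above the customer. *)
Lemma nth_rates L n i : (i < n)%N ->
  nth 0 (rates L n) i = lam * (1 - batch_value L (drop i.+1 (rates L n))).
Proof.
elim: n i => [|n IH] [|i]//=; first by rewrite drop0.
by rewrite ltnS => /IH.
Qed.

Hypotheses (lam_ge0 : 0 <= lam) (p_ge0 : forall n, 0 <= p n)
  (p_le1 : forall n, \sum_(m < n) p m <= 1).

Lemma batch_value01 L th : (forall i, 0 <= nth 0 th i) ->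
  (forall x, 0 <= x -> 0 <= L x <= 1) -> 0 <= batch_value L th <= 1.
Proof.
move=> th0 L01; apply/andP; split.
  apply: sumr_ge0 => m _; rewrite mulr_ge0// prodr_ge0// => j _.
  by case/andP: (L01 _ (th0 j)).
apply: le_trans (p_le1 (size th).+1); apply: ler_sum => m _.
by rewrite ler_piMr// prodr_ile1// => j _; exact: L01.
Qed.

Lemma rates_ge0 L n i : (forall x, 0 <= x -> 0 <= L x <= 1) ->
  0 <= nth 0 (rates L n) i.
Proof.
move=> L01; elim: n i => [|n IH] [|i] //=.
by rewrite mulr_ge0// subr_ge0; case/andP: (batch_value01 IH L01).
Qed.

Lemma batch_value_le L L' th th' : size th = size th' ->
  (forall i, 0 <= nth 0 th' i <= nth 0 th i) ->
  (forall x y, 0 <= y <= x -> 0 <= L x <= L' y) ->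
  batch_value L th <= batch_value L' th'.
Proof.
move=> eth th0 LL; rewrite /batch_value eth; apply: ler_sum => m _.
by apply: ler_wpM2l => //; apply: ler_prod => j _; exact: LL.
Qed.

(** Induction from the top place downwards: smaller exponents and a larger transform both raise
    [batch_value], which lowers the next exponent. The hypothesis on [L x] and [L' y] merges the
    comparison of the transforms with their monotonicity. *)
Lemma rates_le L L' n i : (forall x, 0 <= x -> 0 <= L x <= 1) ->
  (forall x, 0 <= x -> 0 <= L' x <= 1) ->
  (forall x y, 0 <= y <= x -> L x <= L' y) ->
  nth 0 (rates L' n) i <= nth 0 (rates L n) i.
Proof.
move=> L01 L'01 LL'; elim: n i => [|n IH] [|i] //=.
apply: ler_wpM2l => //; rewrite lerD2l lerN2.
apply: batch_value_le => [|j|x y yx]; first by rewrite !size_rates.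
  by rewrite rates_ge0 ?IH.
by rewrite LL'// andbT; case/andP: yx => y0 /(le_trans y0) /L01/andP[].
Qed.

Lemma batch_value_rates_le L L' n : (forall x, 0 <= x -> 0 <= L x <= 1) ->
  (forall x, 0 <= x -> 0 <= L' x <= 1) ->
  (forall x y, 0 <= y <= x -> L x <= L' y) ->
  batch_value L (rates L n) <= batch_value L' (rates L' n).
Proof.
move=> L01 L'01 LL'; apply: batch_value_le => [|j|x y yx].
- by rewrite !size_rates.
- by rewrite rates_ge0 ?rates_le.
- by rewrite LL'// andbT; case/andP: yx => y0 /(le_trans y0) /L01/andP[].
Qed.

End rates.

(** * Exponential interarrival times *)

Section exponential_law.
Context d (T : measurableType d) (R : realType) (P : probability T R).
Local Notation mu := (@lebesgue_measure R).
Variables (lam : R) (A : {RV P >-> R}).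
Hypothesis lam_gt0 : 0 < lam.
Hypothesis A_tail : forall t, 0 <= t ->
  P [set w | t < A w] = (expR (- (lam * t)))%:E.

Local Notation expo := (exponential_prob lam).

(* The library declares [exponential_prob] as a probability on [measurableTypeR] *)
(* rather than on the default measurable structure of [R].                       *)
Local Notation RT := (measurableTypeR R).

Let expoP : probability RT R :=
  exponential_distribution_exponential_prob__canonical__probability_measure_Probability
    lam_gt0.

Let measurable_A : measurable_fun setT (A : T -> RT).
Proof. exact: (measurable_funP A). Qed.

Let AT : {mfun T >-> RT} :=
  HB.pack_for {mfun T >-> RT} (A : T -> RT) (@isMeasurableFun.Build _ _ T RT A measurable_A).

Lemma exponential_prob_gt t : 0 <= t -> expo `]t, +oo[ = (expR (- (lam * t)))%:E.
Proof.
move=> t0; rewrite /exponential_prob integral_itv_obnd_cbnd; last first.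
  apply/measurable_EFinP/measurable_funTS; exact: measurable_exponential_pdf.
rewrite (@ge0_continuous_FTC2y _ _ (fun x => - expR (- lam * x)) _ 0).
- by rewrite EFinN oppeK add0e mulNr.
- by move=> x _; apply: exponential_pdf_ge0; exact: ltW.
- apply: (@continuous_subspaceW R^o _ _ [set` `[0, +oo[%R]).
    by apply: subset_itvr; rewrite bnd_simp.
  exact: within_continuous_exponential_pdf.
- rewrite -oppr0; apply: cvgN.
  rewrite (_ : (fun x => expR (- lam * x)) =
               (fun z => expR (- z)) \o (fun z => lam * z)); last first.
    by apply: eq_fun => x; rewrite mulNr.
  apply: (@cvg_comp _ _ _ _ _ _ (pinfty_nbhs R)); last exact: cvgr_expR.
  exact: gt0_cvgMry.
- by move=> x _; exact: ex_derive.
- apply: cvg_at_right_filter; apply: cvgN.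
  have : {for t, continuous (fun z : R => expR (- lam * z))}.
    apply: differentiable_continuous; apply/derivable1_diffP; exact: ex_derive.
  exact.
- move=> x; rewrite in_itv/= andbT => tx; apply: derive1_exponential_pdf.
  by rewrite in_itv/= andbT (le_lt_trans t0).
Qed.

(** Open half-lines form a generating pi-system. Those starting below 0 have mass 1 under both laws,
    since []0, +oo[] already has. *)
Lemma exponential_law (E : set RT) : measurable E -> distribution P AT E = expo E.
Proof.
move=> mE.
have tail (m : probability RT R) t : t < 0 -> m `]0, +oo[%classic = 1%E ->
    m `]t, +oo[%classic = 1%E.
  move=> t0 m0; apply/eqP; rewrite eq_le probability_le1// -m0.
  by apply: le_measure; rewrite ?inE//; apply: subset_itvr; rewrite bnd_simp ltW.
have dA t : 0 <= t -> distribution P AT `]t, +oo[%classic = (expR (- (lam * t)))%:E.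
  move=> t0; rewrite -A_tail// /distribution/pushforward; congr (P _).
  by apply/seteqP; split=> w /=; rewrite in_itv/= andbT.
pose m1 : probability RT R := distribution P AT.
pose m2 := expoP.
suff : m1 E = m2 E by [].
apply: (@measure_unique _ R RT (@RGenOInfty.G R)
  (fun n => `](- n%:R), +oo[%classic) _ _ _ _ m1 m2) => //.
- exact: RGenOInfty.measurableE.
- move=> _ _ [x ->] [y ->]; exists (Num.max x y); apply/seteqP; split=> z /=;
    by rewrite !in_itv/= !andbT gt_max => /andP.
- by move=> n; exists (- n%:R).
- rewrite -subTset => x _; exists (Num.truncn `|x|).+1 => //=.
  rewrite in_itv/= andbT ltrNl (le_lt_trans (ler_norm _))// normrN.
  by rewrite truncnS_gt.
- move=> _ [t ->]; have [t0|t0] := leP 0 t.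
    exact: etrans (dA t t0) (esym (exponential_prob_gt t0)).
  have m10 : m1 `]0, +oo[%classic = 1%E.
    by rewrite [LHS]dA// mulr0 oppr0 expR0.
  have m20 : m2 `]0, +oo[%classic = 1%E.
    by rewrite [LHS]exponential_prob_gt// mulr0 oppr0 expR0.
  exact: etrans (tail m1 t t0 m10) (esym (tail m2 t t0 m20)).
- by move=> n; rewrite (le_lt_trans (probability_le1 _ _))// ltry.
Qed.

Lemma exponential_prob_dom : expoP `<< mu.
Proof.
apply/null_content_dominatesP => B mB muB.
apply: null_set_integral => //.
by apply/measurable_EFinP/measurable_funTS; exact: measurable_exponential_pdf.
Qed.

(** The density agrees almost everywhere with the Radon-Nikodym derivative of the exponential law;
    the bound [C] supplies integrability. *)
Lemma integral_exponential (U : set R) (phi : R -> R) (C : R) :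
  measurable (U : set RT) -> measurable_fun (setT : set RT) phi -> {in U, forall x, 0 <= phi x <= C} ->
  (\int[P]_(w in A @^-1` U) (phi (A w))%:E =
   \int[mu]_(x in U) (phi x * exponential_pdf lam x)%:E)%E.
Proof.
move=> mU mphi phi0.
have mEphi : measurable_fun U (EFin \o phi).
  by apply/measurable_EFinP; exact: measurable_funTS.
transitivity (\int[distribution P AT]_(x in U) (phi x)%:E)%E.
  rewrite ge0_integral_pushforward//.
  by move=> x xU; rewrite lee_fin; case/andP: (phi0 x xU).
rewrite (eq_measure_integral expoP); last first.
  by move=> E mE _; exact: exponential_law.
have intphi : expoP.-integrable U (EFin \o phi).
  apply: (@le_integrable _ _ _ expoP _ mU _ (cst C%:E)) => //.
    move=> x Ux /=; rewrite lee_fin.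
    have /andP[p0 pC] := phi0 x (mem_set Ux).
    by rewrite !ger0_norm// (le_trans p0).
  exact: finite_measure_integrable_cst.
rewrite -(Radon_Nikodym_change_of_variables exponential_prob_dom)//=.
under [RHS]eq_integral do rewrite EFinM.
have mpdf : measurable_fun U (fun x => (exponential_pdf lam x)%:E).
  by apply/measurable_EFinP/measurable_funTS; exact: measurable_exponential_pdf.
apply: ae_eq_integral => //.
- apply: emeasurable_funM => //; apply: (measurable_int mu).
  apply: (integrableS _ _ (@subsetT _ _)) => //=.
  by apply: Radon_Nikodym_integrable; exact: exponential_prob_dom.
- exact: emeasurable_funM.
- apply: ae_eqe_mul2l => /=.
  rewrite Radon_NikodymE//=; first exact: exponential_prob_dom.
  move=> abmu.
  case: cid => /= h [h1 h2 h3].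
  apply: integral_ae_eq => //=.
  + exact: integrableS h2.
  + by move=> E E01 mE; rewrite -h3.
Qed.

(* [- G] is an antiderivative of [phi] times the density of the exponential law. *)
Lemma integral_exponential_itv (phi G : R -> R) (s x C : R) : 0 <= s -> s <= x ->
  continuous phi -> (forall y, s <= y <= x -> 0 <= phi y <= C) ->
  (forall y : R, is_derive y (1 : R) G (- (lam * expR (- (lam * y)) * phi y))) ->
  (\int[P]_(w in A @^-1` `[s, x[) (phi (A w))%:E = (G s - G x)%:E)%E.
Proof.
move=> s0; rewrite le_eqVlt => /predU1P[->|sx] cphi phi0 dG.
  rewrite (_ : `[x, x[%classic = set0) ?preimage_set0 ?integral_set0 ?subrr//.
  by rewrite -subset0 => y /=; rewrite in_itv/=; case: ltgtP.
have mphi : measurable_fun (setT : set RT) phi by exact: continuous_measurable_fun.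
rewrite (@integral_exponential _ _ C)//; last first.
  move=> y; rewrite inE/= in_itv/= => /andP[sy yx]; apply: phi0.
  by rewrite sy ltW.
have mf : measurable_fun (setT : set RT) (fun y => (phi y * exponential_pdf lam y)%:E).
  apply/measurable_EFinP/measurable_funM => //.
  exact: measurable_exponential_pdf.
rewrite integral_itv_bndo_bndc; last exact: measurable_funTS.
have cG : continuous G.
  by move=> y; apply: differentiable_continuous; apply/derivable1_diffP; exact: ex_derive.
rewrite (@continuous_FTC2 _ _ (fun y => - G y))//.
- by rewrite -EFinB opprK addrC.
- apply: (@continuous_subspaceW R^o _ _ [set` `[0, +oo[%R]).
    by apply: subset_itv; rewrite bnd_simp.
  move=> y; apply: continuousM.
    exact: (continuous_subspaceT cphi).
  exact: within_continuous_exponential_pdf.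
- split=> [y _||].
  + by apply: derivableN; exact: ex_derive.
  + by apply: cvg_at_right_filter; apply: cvgN; exact: cG.
  + by apply: cvg_at_left_filter; apply: cvgN; exact: cG.
- move=> y; rewrite in_itv/= => /andP[sy yx].
  have dGy : derivable G y 1 by exact: ex_derive.
  rewrite derive1E deriveN//.
  rewrite (@derive_val _ _ _ _ _ _ _ (dG y)) opprK exponential_pdfE; last first.
    by rewrite (le_trans s0)// ltW.
  by rewrite mulNr mulrC.
Qed.

End exponential_law.

(** * Measurability of functionals of the stack *)

Section measurable_stack_functions.
Context d (U : measurableType d) (R : realType).

Lemma measurable_value th (f : U -> seq R) : measurable_seq f ->
  measurable_fun setT (fun w => value th (f w)).
Proof.
move=> mf; apply: (measurable_fun_seq_comp (F := fun q _ => value th q)) => // n.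
elim: n => [|n IH] x mx; first exact: measurable_cst.
rewrite (_ : (fun w => _) = fun w =>
    weight th n (x 0%N w) * value th (mkseq (fun i => x i.+1 w) n)).
  apply: measurable_funM; last exact: IH.
  rewrite /weight; case: (n < size th)%N; last exact: measurable_cst.
  apply: (measurableT_comp (f := expR)) => //.
  under eq_fun do rewrite -mulNr.
  by apply: measurable_funM => //; exact: measurable_cst.
apply/funext => w; rewrite /mkseq /= (iotaDl 1 0) -map_comp.
by rewrite size_map size_iota.
Qed.

(** The bonus [c] is paid only while work remains; with [c] equal to [lam^-1] it balances the work
    done until the next arrival. *)
Definition sum_if_nonempty (c : R) (q : seq R) : R :=
  if q is [::] then 0 else \sum_(r <- q) r + c.

Lemma measurable_sum_seq (f : U -> seq R) : measurable_seq f ->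
  measurable_fun setT (fun w => \sum_(r <- f w) r).
Proof.
move=> mf; apply: (measurable_fun_seq_comp (F := fun q _ => \sum_(r <- q) r)) => //.
elim=> [|n IH] x mx; first by under eq_fun do rewrite big_nil; exact: measurable_cst.
rewrite (_ : (fun w => _) = fun w =>
    x 0%N w + \sum_(r <- mkseq (fun i => x i.+1 w) n) r).
  by apply: measurable_funD => //; exact: IH.
by apply/funext => w; rewrite /mkseq /= (iotaDl 1 0) -map_comp big_cons.
Qed.

Lemma measurable_sum_if_nonempty c (f : U -> seq R) : measurable_seq f ->
  measurable_fun setT (fun w => sum_if_nonempty c (f w)).
Proof.
move=> mf; rewrite (_ : (fun w => _) = fun w => if size (f w) == 0%N then 0 else
   \sum_(r <- f w) r + c); last by apply/funext => w; case: (f w).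
apply: measurable_fun_ifT; last 2 first.
- exact: measurable_cst.
- by apply: measurable_funD => //; exact: measurable_sum_seq.
exact: (measurable_fun_nat_comp (g := fun n _ => n == 0%N) mf.1).
Qed.

End measurable_stack_functions.

(** * Draining a stack of nonnegative services *)

Section drain_nonneg.
Context (R : realType).
Implicit Types (q : seq R) (x : R).

Lemma sum_seq_ge0 q : all (>= 0) q -> 0 <= \sum_(r <- q) r.
Proof. by move=> q0; rewrite big_seq sumr_ge0// => i /(allP q0). Qed.

Lemma sum_if_nonempty_ge0 c q : 0 <= c -> all (>= 0) q ->
  0 <= sum_if_nonempty c q.
Proof.
case: q => // r q c0 q0; rewrite /sum_if_nonempty.
by apply: addr_ge0; first exact: (sum_seq_ge0 q0).
Qed.

Lemma drain_ge0 q x : all (>= 0) q -> all (>= 0) (drain q x).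
Proof.
elim: q x => //= r q IH x /andP[r0 q0]; case: ifPn => [_|]; first exact: IH.
by rewrite -ltNge /= q0 andbT subr_ge0 => /ltW.
Qed.

Lemma size_drain q x : (size (drain q x) <= size q)%N.
Proof. by elim: q x => //= r q IH x; case: ifP => // _; rewrite ltnW// ltnS. Qed.

Lemma drain_neq_nil q x : all (>= 0) q -> 0 <= x ->
  (drain q x != [::]) = (x < \sum_(r <- q) r).
Proof.
elim: q x => [|r q IH] x /=; first by rewrite big_nil ltNge => _ ->.
move=> /andP[r0 q0] x0; rewrite big_cons.
have s0 := sum_seq_ge0 q0.
case: ifPn => [rx|]; first by rewrite IH// ?subr_ge0// ltrBlDl.
by rewrite -ltNge => xr /=; rewrite (lt_le_trans xr)// lerDl.
Qed.

Lemma sum_drain q x : all (>= 0) q -> drain q x != [::] ->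
  \sum_(r <- drain q x) r = \sum_(r <- q) r - x.
Proof.
elim: q x => //= r q IH x /andP[r0 q0]; case: ifPn => [rx /IH ->//|_ _].
  by rewrite big_cons; ring.
by rewrite !big_cons; ring.
Qed.

End drain_nonneg.

(** * Averaging over an exponential interarrival time *)

Section drain_exponential.
Context d (T : measurableType d) (R : realType) (P : probability T R).
Variables (lam : R) (A : {RV P >-> R}).
Hypothesis lam_gt0 : 0 < lam.
Hypothesis A_tail : forall t, 0 <= t ->
  P [set w | t < A w] = (expR (- (lam * t)))%:E.

Let measurable_preimage (E : set R) : measurable E -> measurable (A @^-1` E).
Proof. by move=> mE; rewrite -[X in measurable X]setTI; exact: measurable_funP. Qed.

(** The tail formula at 0 makes [A] positive almost surely. *)
Lemma integral_exponential_ge0 (f : T -> \bar R) : measurable_fun setT f ->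
  (forall w, 0 <= f w)%E ->
  (\int[P]_w f w = \int[P]_(w in A @^-1` `[0%R, +oo[) f w)%E.
Proof.
move=> mf f0.
have m0 : measurable (A @^-1` `[0, +oo[) by exact: measurable_preimage.
rewrite -(setvU (A @^-1` `[0, +oo[)) ge0_integral_setU//=; last 3 first.
- exact: measurableC.
- by rewrite setvU.
- exact/disj_setPLR.
rewrite [X in (X + _)%E](_ : _ = 0%E) ?add0e//.
apply: null_set_integral; [exact: measurableC|exact: measurable_funTS|].
apply/eqP; rewrite -measure_le0.
have -> : 0%E = P (~` [set w | 0 < A w]).
  rewrite probability_setC; last first.
    rewrite (_ : [set w | _] = A @^-1` `]0, +oo[); first exact: measurable_preimage.
    by apply/seteqP; split=> w /=; rewrite in_itv/= andbT.
  by rewrite A_tail// mulr0 oppr0 expR0 subee.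
apply: le_measure; rewrite ?inE; [exact: measurableC| |].
  apply: measurableC.
  rewrite (_ : [set w | _] = A @^-1` `]0, +oo[); first exact: measurable_preimage.
  by apply/seteqP; split=> w /=; rewrite in_itv/= andbT.
move=> w /=; rewrite in_itv/= andbT => /negP; rewrite -ltNge => Aw Aw'.
by have := lt_trans Aw Aw'; rewrite ltxx.
Qed.

Lemma is_derive_expR_affine (c al be y : R) :
  is_derive y (1 : R) (fun a => c * expR (al * a + be)) (al * (c * expR (al * y + be))).
Proof.
have h : is_derive y (1 : R) (fun a : R => al * a + be) al.
  by apply: is_derive_eq; rewrite /= addr0 scaler1.
have := @is_derive1_comp R expR (fun a => al * a + be) y _ _
  (is_derive_expR (al * y + be)) h.
move=> /(is_deriveZ c) /is_derive_eq; apply.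
by rewrite /GRing.scale/=; ring.
Qed.

(** The mean work done before the arrival, E min(A, x), equals [lam^-1] times P(A < x), so the bonus
    restores exactly the work lost. *)
Lemma integral_drain_sum q : all (>= 0) q ->
  (\int[P]_w (sum_if_nonempty lam^-1 (drain q (A w)))%:E = (\sum_(r <- q) r)%:E)%E.
Proof.
move=> q0; set x := \sum_(r <- q) r.
have x0 : 0 <= x by exact: sum_seq_ge0.
pose f (a : R) := if a < x then x - a + lam^-1 else 0.
have mf : measurable_fun setT f.
  apply: measurable_fun_ifT; last exact: measurable_cst.
    exact: measurable_fun_ltr.
  by apply: measurable_funD => //; exact: measurable_funB.
have f0 a : 0 <= f a.
  rewrite /f; case: ifP => // ax.
  by rewrite addr_ge0 ?invr_ge0 ?subr_ge0// ltW.
have mg : measurable_fun setT (fun w => sum_if_nonempty lam^-1 (drain q (A w))).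
  apply/measurable_sum_if_nonempty/measurable_seq_drain.
    exact: measurable_seq_cst.
  exact: measurable_funP.
have gE w : 0 <= A w -> sum_if_nonempty lam^-1 (drain q (A w)) = f (A w).
  move=> Aw; rewrite /f /x -drain_neq_nil//.
  by have := @sum_drain _ q (A w) q0; case: drain => [|r u]//= ->.
rewrite integral_exponential_ge0; last 2 first.
- exact/measurable_EFinP.
- move=> w; rewrite lee_fin sum_if_nonempty_ge0 ?invr_ge0 ?(ltW lam_gt0)//.
  exact: drain_ge0.
under eq_integral => w /[!inE]/= /[!in_itv]/= /[!andbT] Aw do rewrite gE//.
have -> : `[0, +oo[%classic = `[0, x[%classic `|` `[x, +oo[%classic :> set R.
  by rewrite -itv_bndbnd_setU// bnd_simp.
have mi (i : interval R) : measurable (A @^-1` [set` i]) by exact: measurable_preimage.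
have mfA D : measurable_fun D (fun w => (f (A w))%:E).
  by apply/measurable_EFinP/measurable_funTS; exact: measurableT_comp.
rewrite preimage_setU ge0_integral_setU//=; last 2 first.
- by move=> w _; rewrite lee_fin.
- apply/eqP; rewrite -preimage_setI -subset0 => w /=.
  by rewrite !in_itv/= andbT => -[/andP[_ Ax]]; rewrite leNgt Ax.
rewrite [X in (_ + X)%E]integral0_eq ?adde0; last first.
  by move=> w /=; rewrite in_itv/= andbT /f leNgt => /negbTE ->.
under eq_integral => w /[!inE]/= /[!in_itv]/= /andP[_ Ax] do rewrite /f Ax.
pose G (a : R) := expR (- (lam * a)) * (x - a).
pose phi (a : R) := x - a + lam^-1.
have cphi : continuous phi.
  by move=> y; apply: differentiable_continuous; apply/derivable1_diffP.
have phi0 y : 0 <= y <= x -> 0 <= phi y <= x + lam^-1.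
  move=> /andP[y0 yx]; rewrite addr_ge0 ?subr_ge0 ?invr_ge0 ?(ltW lam_gt0)//=.
  by rewrite lerD2r lerBlDr lerDl.
have dG (y : R) : is_derive y (1 : R) G (- (lam * expR (- (lam * y)) * phi y)).
  have h1 := is_derive_expR_affine 1 (- lam) 0 y.
  have h2 : is_derive y (1 : R) (fun a : R => x - a) (-1).
    have := is_deriveB (is_derive_cst x y (1 : R)) (is_derive_id y (1 : R)).
    by move=> /is_derive_eq; apply; rewrite sub0r.
  rewrite (_ : G = (fun a => 1 * expR (- lam * a + 0)) * (fun a => x - a)); last first.
    by apply/funext => a; rewrite /G [RHS]/GRing.mul/= mul1r addr0 mulNr.
  have /is_derive_eq := is_deriveM h1 h2; apply.
  rewrite /GRing.scale/= !mul1r addr0 mulNr /phi; field.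
  by rewrite gt_eqF.
have := @integral_exponential_itv _ _ _ _ _ _ lam_gt0 A_tail phi G 0 x _
  (lexx 0) x0 cphi phi0 dG.
have -> : G 0 - G x = x by rewrite /G subrr !mulr0 !subr0 oppr0 expR0 mul1r.
exact.
Qed.

Variables (th : seq R) (g : seq R -> R).
Hypothesis g01 : forall i, (i < size th)%N -> 0 <= g (drop i.+1 th) <= 1.
Hypothesis thE : forall i, (i < size th)%N ->
  nth 0 th i = lam * (1 - g (drop i.+1 th)).

(** The mean of [value] after a batch has joined the stack [q], the batch contributing the factor
    [g]. If the arrival finds nobody, the busy period has ended safely: 1. *)
Definition arrival_value q : R :=
  if q is [::] then 1 else g (drop (size q) th) * value th q.

Lemma arrival_value_ge0 q : (size q <= size th)%N -> 0 <= arrival_value q.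
Proof.
case: q => [|r q] //= qth.
by rewrite mulr_ge0 ?(value_ge0 th (r :: q))//; case/andP: (g01 qth).
Qed.

Lemma measurable_arrival_value d' (U : measurableType d') (f : U -> seq R) :
  measurable_seq f -> measurable_fun setT (fun w => arrival_value (f w)).
Proof.
move=> mf; rewrite (_ : (fun w => _) = fun w => if size (f w) == 0%N then 1 else
   g (drop (size (f w)) th) * value th (f w)); last first.
  by apply/funext => w; case: (f w).
apply: measurable_fun_ifT; last 2 first.
- exact: measurable_cst.
- apply: measurable_funM; last exact: measurable_value.
  exact: (measurable_fun_nat_comp (g := fun n _ => g (drop n th)) mf.1).
- exact: (measurable_fun_nat_comp (g := fun n _ => n == 0%N) mf.1).
Qed.

Lemma exponential_ge (s : R) : 0 <= s ->
  P (A @^-1` `[s, +oo[) = (expR (- (lam * s)))%:E.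
Proof.
move=> s0; rewrite -[LHS]mul1e -integral_cst//; last exact: measurable_preimage.
rewrite (@integral_exponential _ _ _ _ _ _ lam_gt0 A_tail _ (cst 1) 1)//; last first.
  by move=> x _; rewrite ler01 lexx.
under eq_integral do rewrite mul1r.
rewrite -exponential_prob_gt// /exponential_prob integral_itv_obnd_cbnd//.
by apply/measurable_EFinP/measurable_funTS; exact: measurable_exponential_pdf.
Qed.

(* Shifting the time origin by [s] lets memorylessness be used while emptying *)
(* the stack one customer at a time.                                          *)
Lemma integral_drain_value_from q (s : R) : all (>= 0) q ->
  (size q <= size th)%N -> 0 <= s ->
  (\int[P]_(w in A @^-1` `[s, +oo[) (arrival_value (drain q (A w - s)))%:E =
   (expR (- (lam * s)) * value th q)%:E)%E.
Proof.
have mi (i : interval R) : measurable (A @^-1` [set` i]) by exact: measurable_preimage.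
elim: q s => [|r q IH] s.
  move=> _ _ s0 /=; rewrite mulr1 -exponential_ge//.
  by rewrite integral_cst ?mul1e//; exact: mi.
move=> /= /andP[r0 q0] qth s0.
have -> : `[s, +oo[%classic = `[s, s + r[%classic `|` `[s + r, +oo[%classic :> set R.
  by rewrite -itv_bndbnd_setU// bnd_simp lerDl.
have mdr : measurable_fun setT (fun w => (arrival_value (drain (r :: q) (A w - s)))%:E).
  apply/measurable_EFinP/measurable_arrival_value/measurable_seq_drain.
    exact: measurable_seq_cst.
  exact: measurable_funB.
rewrite preimage_setU ge0_integral_setU//=; last 3 first.
- exact: measurable_funTS.
- move=> w _; rewrite lee_fin arrival_value_ge0//.
  by rewrite (leq_trans _ qth)// (size_drain (r :: q)).
- apply/eqP; rewrite -preimage_setI -subset0 => w /=.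
  by rewrite !in_itv/= andbT => -[/andP[_ Ax]]; rewrite leNgt Ax.
pose v := value th q; pose ti := nth 0 th (size q).
(* By [thE], [ti - lam] is [- (lam * g)], so [- G] is an antiderivative of [phi] times the
   exponential density. *)
pose G (a : R) := v * expR ((ti - lam) * a + - (ti * (r + s))).
pose phi (a : R) := (g (drop (size q).+1 th) * v) * expR (ti * a + - (ti * (r + s))).
rewrite (eq_integral (fun w => (phi (A w))%:E)); last first.
  move=> w; rewrite inE/= in_itv/= => /andP[sA As].
  rewrite leNgt ltrBlDl As /= /weight qth -/ti /phi -/v; congr _%:E.
  rewrite -!mulrA; congr (_ * _); rewrite mulrC; congr (_ * expR _); ring.
have ti0 : 0 <= ti.
  by rewrite /ti thE// mulr_ge0 ?(ltW lam_gt0)// subr_ge0; case/andP: (g01 qth).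
have /andP[g0 g1] := g01 qth.
have v0 : 0 <= v by exact: value_ge0.
have cphi : continuous phi.
  move=> y; apply: differentiable_continuous; apply/derivable1_diffP.
  by have := is_derive_expR_affine (g (drop (size q).+1 th) * v) ti (- (ti * (r + s))) y; case.
have phi0 y : s <= y <= s + r -> 0 <= phi y <= g (drop (size q).+1 th) * v.
  move=> /andP[sy yr]; rewrite mulr_ge0 ?mulr_ge0 ?expR_ge0//=.
  rewrite ler_piMr ?mulr_ge0// -expR0 ler_expR subr_le0 ler_wpM2l//.
  by rewrite addrC.
have dG (y : R) : is_derive y (1 : R) G (- (lam * expR (- (lam * y)) * phi y)).
  have := is_derive_expR_affine v (ti - lam) (- (ti * (r + s))) y.
  move=> /is_derive_eq; apply; rewrite /phi.
  rewrite (_ : (ti - lam) * y - ti * (r + s) =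
     (- (lam * y)) + (ti * y - ti * (r + s))); last by ring.
  by rewrite expRD {1}/ti thE//; ring.
have ssr : s <= s + r by rewrite lerDl.
have -> := @integral_exponential_itv _ _ _ _ _ _ lam_gt0 A_tail phi G s (s + r) _
  s0 ssr cphi phi0 dG.
rewrite (eq_integral (fun w => (arrival_value (drain q (A w - (s + r))))%:E)); last first.
  move=> w; rewrite inE/= in_itv/= andbT => As.
  by rewrite lerBrDl As opprD addrA.
(* [G s] is the claimed value, and [G (s + r)] cancels against the induction hypothesis. *)
rewrite IH// ?(ltnW qth) ?addr_ge0// -EFinD; congr _%:E.
rewrite /G -/v /weight qth -/ti.
rewrite (_ : (ti - lam) * s - ti * (r + s) = - (lam * s) - ti * r); last by ring.
rewrite (_ : (ti - lam) * (s + r) - ti * (r + s) = - (lam * (s + r))); last by ring.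
by rewrite expRD; ring.
Qed.

(** Arrivals at rate [lam], each survived with probability [g], kill the customer in service at rate
    [lam * (1 - g)], which is its exponent by [thE]. *)
Lemma integral_drain_value q : all (>= 0) q -> (size q <= size th)%N ->
  (\int[P]_w (arrival_value (drain q (A w)))%:E = (value th q)%:E)%E.
Proof.
move=> q0 qth; rewrite integral_exponential_ge0.
- have := integral_drain_value_from q0 qth (lexx 0).
  rewrite mulr0 oppr0 expR0 mul1r => <-; apply: eq_integral => w _.
  by rewrite addr0.
- apply/measurable_EFinP/measurable_arrival_value/measurable_seq_drain.
    exact: measurable_seq_cst.
  exact: measurable_funP.
- by move=> w; rewrite lee_fin arrival_value_ge0// (leq_trans (size_drain _ _)).
Qed.

End drain_exponential.

(** * Measurability of batch sizes and stacks *)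

Section measurable_queue.
Context d (U : measurableType d) (R : realType).

Lemma measurable_truncn (f : U -> R) : measurable_fun setT f ->
  measurable_fun setT (fun w => Num.truncn (f w)).
Proof.
move=> mf; apply: measurable_fun_nat => n.
have mfi (i : interval R) : measurable (f @^-1` [set` i]).
  by rewrite -[X in measurable X]setTI; exact: mf.
(* Negative reals are truncated to 0, so nothing is removed when [n] is 0. *)
rewrite (_ : _ @^-1` _ = f @^-1` `]-oo, n.+1%:R[%classic `\`
    (if n is n'.+1 then f @^-1` `]-oo, n'.+1%:R[%classic else set0)).
  by apply: measurableD => //; case: n.
apply/seteqP; split=> w /=; rewrite in_itv/= -truncn_le_nat.
  move=> fn; rewrite fn; split=> //; case: n fn => [_ []//|n fn] /=.
  by rewrite in_itv/= -truncn_le_nat fn ltnn.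
case: n => [|n] /=; first by rewrite leqn0 => -[/eqP].
by rewrite in_itv/= -truncn_le_nat => -[fn /negP]; rewrite -ltnNge => nf; apply/eqP; rewrite eqn_leq fn.
Qed.

Lemma measurable_stack_at (A : nat -> U -> R) (N : nat -> U -> nat)
    (S : nat -> nat -> U -> R) k :
  (forall i, (i < k)%N -> measurable_fun setT (A i)) ->
  (forall i, (i <= k)%N -> measurable_fun setT (N i)) ->
  (forall i j, (i <= k)%N -> measurable_fun setT (S i j)) ->
  measurable_seq (fun w => stack_at (A^~ w) (N^~ w) (fun i j => S i j w) k).
Proof.
elim: k => [|k IH] mA mN mS.
  apply: (@measurable_seq_batch _ U R (N 0%N) S 0) => [|j]; first exact: mN.
  exact: mS.
apply: measurable_seq_arrive.
- apply: IH => i *; [apply: mA|apply: mN|apply: mS]; by rewrite ltnW.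
- exact: mA.
- apply: (@measurable_seq_batch _ U R (N k.+1) S k.+1) => [|j]; first exact: mN.
  exact: mS.
Qed.

End measurable_queue.

(** * The queue with nonnegative service times *)

Section queue.
Context d (T : measurableType d) (R : realType) (P : probability T R).
Variables (lam : R) (p : nat -> R).
Variables (A B : nat -> {RV P >-> R}) (S : nat -> nat -> {RV P >-> R}).
Hypothesis lam_gt0 : 0 < lam.
Hypothesis p_ge0 : forall n, 0 <= p n.
Hypothesis p_sum : (fun N : nat => \sum_(n < N) p n) @ \oo --> (1 : R).
Hypothesis inputs : MX_G_1_inputs P lam p A B S.
Hypothesis S_ge0 : forall k j w, 0 <= S k j w.

Let X i := match i with IA n => A n | IB n => B n | IS k j => S k j end.
Let N k w := Num.truncn (B k w).
Let batch k w := batch_stack (N^~ w) (fun i j => S i j w) k.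
Let Q k w := stack_at (A^~ w) (N^~ w) (fun i j => S i j w) k.
Local Notation sigma J := (g_sigma_algebraType (cylinders X J)).

Let indX : mutually_independent P X. Proof. by case: inputs. Qed.

Let A_tail k t : 0 <= t -> P [set w | t < A k w] = (expR (- (lam * t)))%:E.
Proof. by case: inputs => _ + _ _ _; exact. Qed.

Let mS J k j : J (IS k j) -> measurable_fun setT (S k j : sigma J -> R).
Proof. exact: (@measurable_sigma_var _ _ _ _ _ X J (IS k j)). Qed.
Let mA J k : J (IA k) -> measurable_fun setT (A k : sigma J -> R).
Proof. exact: (@measurable_sigma_var _ _ _ _ _ X J (IA k)). Qed.
Let mN J k : J (IB k) -> measurable_fun setT (N k : sigma J -> nat).
Proof.
move=> Jk; apply: (@measurable_truncn _ (sigma J) R (B k)).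
exact: (@measurable_sigma_var _ _ _ _ _ X J (IB k)).
Qed.

(** * Laws of the batch sizes and of the services in a batch *)

Lemma sum_p_le1 n : \sum_(m < n) p m <= 1.
Proof.
have nd : nondecreasing_seq (fun n => \sum_(m < n) p m).
  by apply/nondecreasing_seqP => k; rewrite big_ord_recr/= lerDl.
rewrite -(cvg_lim _ p_sum)//; apply: nondecreasing_cvgn_le => //.
by apply/cvg_ex; exists 1.
Qed.

Let mNT k : measurable_fun setT (N k).
Proof. by apply: measurable_truncn; exact: measurable_funP. Qed.

Let mNk k m : measurable [set w | N k w = m].
Proof.
by rewrite -[X in measurable X]/(N k @^-1` [set m])
  -[X in measurable X]setTI; exact: mNT.
Qed.

(** Truncation can only enlarge the event that [B k] equals [m]; as the [p n] already sum to 1, no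
    mass is left for a strict increase. *)
Lemma prob_batch_size k m : P [set w | N k w = m] = (p m)%:E.
Proof.
have [_ _ Bp _ _] := inputs.
pose q m := fine (P [set w | N k w = m]).
have qE n : P [set w | N k w = n] = (q n)%:E by rewrite fineK// fin_num_measure.
have pq n : p n <= q n.
  rewrite -lee_fin -qE -(Bp k); apply: le_measure; rewrite ?inE//.
    by rewrite -[X in measurable X]setTI; exact: (measurable_funP (B k) measurableT [set n%:R]).
  by move=> w /= Bw; rewrite /N Bw natrK.
have q1 n : \sum_(i < n) q i <= 1.
  rewrite -lee_fin -sumEFin; under eq_bigr do rewrite -qE.
  rewrite -(@measure_semi_additive_ord _ _ _ P n (fun i : 'I_n => [set w | N k w = i]))//.
  - by apply: probability_le1; exact: bigsetU_measurable.
  - by move=> i j _ _ [w [/= -> /val_inj]].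
  - exact: bigsetU_measurable.
rewrite qE; congr _%:E; apply/eqP; rewrite eq_le pq andbT.
suff h n : (m < n)%N -> q m - p m <= 1 - \sum_(i < n) p i.
  have : (fun n => 1 - \sum_(i < n) p i) @ \oo --> (1 - 1 : R).
    by apply: cvgB p_sum; exact: cvg_cst.
  rewrite subrr => c0; rewrite -subr_le0 -(cvg_lim _ c0)//.
  apply: limr_ge; first by apply/cvg_ex; exists 0.
  by exists m.+1 => // n /= mn; exact: h.
move=> mn; rewrite lerBrDr (le_trans _ (q1 n))//.
rewrite (bigD1 (Ordinal mn))//= [leRHS](bigD1 (Ordinal mn))//= addrA subrK.
by rewrite lerD2l ler_sum.
Qed.

Lemma integral_service (phi : R -> R) k j : measurable_fun setT phi ->
  (forall x, 0 <= phi x) ->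
  (\int[P]_w (phi (S k j w))%:E = \int[P]_w (phi (S 0 0 w))%:E)%E.
Proof.
move=> mphi phi0; have [_ _ _ Sid _] := inputs.
have mEphi : measurable_fun setT (EFin \o phi) by exact/measurable_EFinP.
rewrite -(ge0_integral_distribution (S k j) mEphi)// -(ge0_integral_distribution (S 0 0) mEphi)//.
by apply: eq_measure_integral => E mE _; exact: Sid.
Qed.

(** Induction on [i]: the batch size and the first [i] services are independent of the next
    service. *)
Lemma integral_batch_prod k m i (phi : nat -> R -> R) (e : nat -> R) :
  (forall j, measurable_fun setT (phi j)) -> (forall j x, 0 <= phi j x) ->
  (forall j, \int[P]_w (phi j (S 0 0 w))%:E = (e j)%:E)%E ->
  (\int[P]_w ((N k w == m)%:R * \prod_(j < i) phi j (S k j w))%:E =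
   (p m * \prod_(j < i) e j)%:E)%E.
Proof.
move=> mphi phi0 phie.
elim: i => [|i IH].
  rewrite big_ord0 mulr1 -(prob_batch_size k) -[X in P X]setIT -integral_indic//.
  apply: eq_integral => w _; rewrite big_ord0 mulr1 indicE; congr (_%:R)%:E.
  by case: eqP => h; [rewrite mem_set|rewrite memNset].
pose J : set qidx := [set x | match x with IA _ => False | IB n => n = k
   | IS n j => n = k /\ (j < i)%N end].
pose K : set qidx := [set x | x = IS k i].
have JK x : J x -> K x -> False.
  by rewrite /K/= => + xE; rewrite xE /= => -[_]; rewrite ltnn.
pose f (z : sigma J * sigma K) : \bar R :=
  ((N k z.1 == m)%:R * \prod_(j < i) phi j (S k j z.1) * phi i (S k i z.2))%:E.
have mprod n : (n <= i)%N ->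
    measurable_fun setT (fun w : sigma J => \prod_(j < n) phi j (S k j w)).
  elim: n => [_|n IHn ni].
    by under eq_fun do rewrite big_ord0; exact: measurable_cst.
  under eq_fun do rewrite big_ord_recr/=.
  apply: measurable_funM; first exact: (IHn (ltnW ni)).
  apply: measurableT_comp; [exact: mphi|apply: (@mS J)].
  by [].
have mh : measurable_fun setT (fun w : sigma J =>
    (N k w == m)%:R * \prod_(j < i) phi j (S k j w)).
  apply: measurable_funM; last exact: mprod.
  apply: (@measurable_fun_nat_comp _ (sigma J) _ R (N k) (fun n _ => (n == m)%:R)) => //.
  exact: (@mN J).
have mg : measurable_fun setT (fun w : sigma K => phi i (S k i w)).
  by apply: measurableT_comp => //; apply: (@mS K).
have h0 w : 0 <= (N k w == m)%:R * \prod_(j < i) phi j (S k j w).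
  by rewrite mulr_ge0// prodr_ge0.
transitivity (\int[P]_w f (w, w))%E.
  by apply: eq_integral => w _; rewrite /f/= big_ord_recr/= mulrA.
rewrite (integral_diagonal indX JK); last 2 first.
- apply/measurable_EFinP/measurable_funM.
    exact: (measurableT_comp mh measurable_fst).
  exact: (measurableT_comp mg measurable_snd).
- by move=> z; rewrite lee_fin mulr_ge0.
transitivity (\int[P]_w ((N k w == m)%:R * \prod_(j < i) phi j (S k j w) * e i)%:E)%E.
  apply: eq_integral => w _; rewrite /f/= EFinM -phie -(@integral_service (phi i) k i)//.
  under eq_integral do rewrite EFinM.
  rewrite ge0_integralZl_EFin//; last 2 first.
  - by move=> w' _; rewrite lee_fin.
  - apply/measurable_EFinP/measurableT_comp => //; exact: measurable_funP.
have e0 : 0 <= e i by rewrite -lee_fin -phie integral_ge0// => w _; rewrite lee_fin.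
under eq_integral do rewrite EFinM.
rewrite ge0_integralZr//.
- by rewrite IH -EFinM big_ord_recr/= mulrA.
- apply/measurable_EFinP.
  exact: (measurableT_comp mh (@measurable_sigma_id _ _ _ _ _ X J)).
- by move=> w _; rewrite lee_fin.
Qed.

(** * Conditioning on the past of an arrival *)

Let past k : set qidx := [set i | match i with
  | IA n => (n < k)%N | IB n => (n <= k)%N | IS n _ => (n <= k)%N end].
(** Passing from stack [k] to stack [k.+1] uses interarrival time [k] and batch [k.+1]; [arrivals]
    and [batches] separate these two sources. *)
Let fresh k : set qidx := [set i | match i with
  | IA n => n = k | IB n => n = k.+1 | IS n _ => n = k.+1 end].
Let arrivals k : set qidx := [set i | if i is IA n then n = k else False].
Let batches k : set qidx := [set i | match i with
  | IA _ => False | IB n => n = k | IS n _ => n = k end].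

Lemma batch_ge0 k w : all (>= 0) (batch k w).
Proof. by rewrite /batch /batch_stack all_rev all_map; apply/allP => j _ /=. Qed.

Lemma arrive_ge0 (q u : seq R) x : all (>= 0) q -> all (>= 0) u ->
  all (>= 0) (arrive q x u).
Proof.
move=> q0 u0; rewrite /arrive; have := drain_ge0 x q0.
by case: drain => // r v rv0; rewrite all_cat u0.
Qed.

Lemma stack_ge0 k w : all (>= 0) (Q k w).
Proof. by elim: k => [|k IH]; [exact: (batch_ge0 0)|exact: (arrive_ge0 _ IH (batch_ge0 _ _))]. Qed.

Lemma measurable_stack k m : (k <= m)%N ->
  measurable_seq (Q k : sigma (past m) -> seq R).
Proof.
move=> km; apply: (@measurable_stack_at _ (sigma (past m)) R A N S).
- by move=> i ik; apply: (@mA (past m)); exact: leq_trans km.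
- by move=> i ik; apply: (@mN (past m)); exact: leq_trans km.
- by move=> i j ik; apply: (@mS (past m)); exact: leq_trans km.
Qed.

Lemma measurable_batch J k : J (IB k) -> (forall j, J (IS k j)) ->
  measurable_seq (batch k : sigma J -> seq R).
Proof.
move=> JB JS; apply: (@measurable_seq_batch _ (sigma J) R (N k) S k).
  exact: (@mN J).
by move=> j; exact: (@mS J).
Qed.

Lemma measurable_batchT k : measurable_seq (batch k).
Proof.
apply: (@measurable_seq_batch _ T R (N k) S k); first exact: mNT.
by move=> j; exact: measurable_funP.
Qed.

(** The Markov property in integrated form: [integral_diagonal] freezes first the past, then the
    interarrival time. *)
Lemma integral_next k (psi : sigma (past k) -> R) (H : seq R -> R -> seq R -> R) :
  measurable_fun setT psi -> (forall w, 0 <= psi w) ->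
  (forall d' (U : measurableType d') f x g, measurable_seq f ->
    measurable_fun setT x -> measurable_seq g ->
    measurable_fun setT (fun w : U => H (f w) (x w) (g w))) ->
  (forall q x u, all (>= 0) q -> all (>= 0) u -> 0 <= H q x u) ->
  (\int[P]_w (psi w * H (Q k w) (A k w) (batch k.+1 w))%:E =
   \int[P]_w ((psi w)%:E *
     \int[P]_w1 \int[P]_w2 (H (Q k w) (A k w1) (batch k.+1 w2))%:E))%E.
Proof.
move=> mpsi psi0 mH H0.
have disj1 x : past k x -> fresh k x -> False.
  by case: x => [n|n|n j] /= + nk; rewrite nk ltnn.
have disj2 x : arrivals k x -> batches k.+1 x -> False by case: x.
pose f (z : sigma (past k) * sigma (fresh k)) : \bar R :=
  (psi z.1 * H (Q k z.1) (A k z.2) (batch k.+1 z.2))%:E.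
have mcomp1 d1 d2 (U1 : measurableType d1) (U2 : measurableType d2) (g : U1 -> seq R) :
    measurable_seq g -> measurable_seq (fun z : U1 * U2 => g z.1).
  by move=> [sg ng]; split=> [|i];
    [exact: (measurableT_comp sg measurable_fst)|
     exact: (measurableT_comp (ng i) measurable_fst)].
have mcomp2 d1 d2 (U1 : measurableType d1) (U2 : measurableType d2) (g : U2 -> seq R) :
    measurable_seq g -> measurable_seq (fun z : U1 * U2 => g z.2).
  by move=> [sg ng]; split=> [|i];
    [exact: (measurableT_comp sg measurable_snd)|
     exact: (measurableT_comp (ng i) measurable_snd)].
transitivity (\int[P]_w f (w, w))%E; first by [].
rewrite (integral_diagonal indX disj1); last 2 first.
- apply/measurable_EFinP/measurable_funM.
    exact: (measurableT_comp mpsi measurable_fst).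
  apply: mH; first by apply: mcomp1; exact: measurable_stack.
    have mAk : measurable_fun setT (A k : sigma (fresh k) -> R) by exact: (@mA (fresh k)).
    exact: (measurableT_comp mAk measurable_snd).
  by apply: mcomp2; exact: measurable_batch.
- move=> z; rewrite lee_fin mulr_ge0// H0//; [exact: stack_ge0|exact: batch_ge0].
apply: eq_integral => w _; rewrite /f/=.
under eq_integral do rewrite EFinM.
rewrite ge0_integralZl_EFin//; last 2 first.
- move=> w' _; rewrite lee_fin H0//; [exact: stack_ge0|exact: batch_ge0].
- apply/measurable_EFinP/mH; first exact: measurable_seq_cst.
    exact: measurable_funP.
  exact: measurable_batchT.
congr (_ * _)%E.
pose f2 (z : sigma (arrivals k) * sigma (batches k.+1)) : \bar R :=
  (H (Q k w) (A k z.1) (batch k.+1 z.2))%:E.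
transitivity (\int[P]_w' f2 (w', w'))%E; first by [].
rewrite (integral_diagonal indX disj2)//.
- apply/measurable_EFinP/mH; first exact: measurable_seq_cst.
    have mAk : measurable_fun setT (A k : sigma (arrivals k) -> R).
      exact: (@mA (arrivals k)).
    exact: (measurableT_comp mAk measurable_fst).
  by apply: mcomp2; exact: measurable_batch.
- move=> z; rewrite lee_fin H0//; [exact: stack_ge0|exact: batch_ge0].
Qed.

(** * The Laplace transform of the service time *)

Definition laplace (x : R) : R := fine (\int[P]_w (expR (- (x * S 0 0 w)))%:E).

Let measurable_expS x : measurable_fun setT (fun y : R => expR (- (x * y))).
Proof.
apply: (measurableT_comp (f := expR)) => //.
under eq_fun do rewrite -mulNr.
by apply: measurable_funM => //; exact: measurable_cst.
Qed.

Lemma integral_expS_le1 x : 0 <= x ->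
  (\int[P]_w (expR (- (x * S 0 0 w)))%:E <= 1)%E.
Proof.
move=> x0; have -> : 1%E = (\int[P]_w (cst 1%E w) : \bar R)%E.
  by rewrite integral_cst// mul1e; apply/esym; exact: (@probability_setT _ _ _ P).
apply: ge0_le_integral => //.
- apply/measurable_EFinP/(measurableT_comp (measurable_expS x)).
  exact: measurable_funP.
- by move=> w _ /=; rewrite lee_fin -expR0 ler_expR oppr_le0 mulr_ge0.
Qed.

Lemma laplaceE x : 0 <= x ->
  (\int[P]_w (expR (- (x * S 0 0 w)))%:E = (laplace x)%:E)%E.
Proof.
move=> x0; rewrite /laplace fineK// ge0_fin_numE.
  by rewrite (le_lt_trans (integral_expS_le1 x0))// ltry.
by apply: integral_ge0 => w _; rewrite lee_fin expR_ge0.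
Qed.

Lemma laplace01 x : 0 <= x -> 0 <= laplace x <= 1.
Proof.
move=> x0; rewrite -!lee_fin -laplaceE// integral_expS_le1// andbT.
by apply: integral_ge0 => w _; rewrite lee_fin expR_ge0.
Qed.

Lemma laplace_anti x y : 0 <= x <= y -> laplace y <= laplace x.
Proof.
move=> /andP[x0 xy]; rewrite -lee_fin -!laplaceE//; last exact: le_trans xy.
apply: ge0_le_integral => //.
- apply/measurable_EFinP/(measurableT_comp (measurable_expS y)).
  exact: measurable_funP.
- apply/measurable_EFinP/(measurableT_comp (measurable_expS x)).
  exact: measurable_funP.
- by move=> w _ /=; rewrite lee_fin ler_expR lerN2 ler_wpM2r.
Qed.

(** Batches larger than [size th] have value 0; splitting by batch size leaves the finite sum in
    [batch_value]. *)
Lemma integral_value_batch k th : (forall i, 0 <= nth 0 th i) ->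
  (\int[P]_w (value th (batch k w))%:E = (batch_value p laplace th)%:E)%E.
Proof.
move=> th0.
have vE w : value th (batch k w) = \sum_(m < (size th).+1)
    (N k w == m)%:R * \prod_(j < m) expR (- (nth 0 th j * S k j w)).
  have [Nth|Nth] := leqP (N k w) (size th).
    rewrite (bigD1 (Ordinal (Nth : (N k w < (size th).+1)%N)))//= eqxx mul1r.
    rewrite [X in _ + X]big1 ?addr0; last first.
      by move=> i; rewrite -val_eqE /= eq_sym => /negbTE ->; rewrite mul0r.
    rewrite /batch /batch_stack value_rev_map; apply: eq_bigr => j _.
    by rewrite /weight (leq_trans (ltn_ord j)).
  rewrite big1 => [|i _].
    by rewrite value_oversize// /batch /batch_stack size_rev size_map size_iota.
  by rewrite gtn_eqF ?mul0r// (leq_trans (ltn_ord i)).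
under eq_integral do rewrite vE -sumEFin.
rewrite ge0_integral_sum//; last 2 first.
- move=> m; apply/measurable_EFinP/measurable_funM.
    by apply: (@measurable_fun_nat_comp _ T _ R (N k) (fun n _ => (n == m)%:R)).
  apply: measurable_prod => j _; apply: (measurableT_comp (measurable_expS _)).
  exact: measurable_funP.
- by move=> m w _; rewrite lee_fin mulr_ge0// prodr_ge0// => j _; exact: expR_ge0.
rewrite -sumEFin; apply: eq_bigr => m _.
exact: (integral_batch_prod (phi := fun j y => expR (- (nth 0 th j * y)))
  (e := fun j => laplace (nth 0 th j)) k m m (fun j => measurable_expS _)
  (fun j x => expR_ge0 _) (fun j => laplaceE (th0 j))).
Qed.

(** * Paths that have stayed within the capacity *)

Fixpoint bounded n k w : bool :=
  (size (Q k w) <= n)%N && (if k is k'.+1 then bounded n k' w else true).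

Lemma bounded_size n k w : bounded n k w -> (size (Q k w) <= n)%N.
Proof. by case: k => [|k] /andP[]. Qed.

Lemma boundedP n w :
  (forall k, bounded n k w) <-> (forall k, (size (Q k w) <= n)%N).
Proof.
split=> [bw k|Qw]; first exact: bounded_size.
by elim=> [|k IH]; apply/andP; split=> //; exact: Qw.
Qed.

Lemma bounded_decr n w k m : (k <= m)%N -> bounded n m w -> bounded n k w.
Proof.
move=> /subnK <-; elim: (m - k)%N => [//|i IH].
by rewrite addSn /= => /andP[_ /IH].
Qed.

Lemma measurable_bounded n k m : (k <= m)%N ->
  measurable_fun setT (fun w : sigma (past m) => (bounded n k w)%:R : R).
Proof.
move=> km; have msize i : (i <= m)%N ->
    measurable_fun setT (fun w : sigma (past m) => (size (Q i w) <= n)%N%:R : R).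
  move=> im; apply: (@measurable_fun_nat_comp _ (sigma (past m)) _ R
    (fun w => size (Q i w)) (fun s _ => (s <= n)%N%:R)) => //.
  by case: (measurable_stack im).
elim: k km => [|k IH] km /=.
  by under eq_fun do rewrite andbT; exact: (msize 0%N).
under eq_fun do rewrite -mulnb natrM.
by apply: measurable_funM; [exact: (msize k.+1)|exact: (IH (ltnW km))].
Qed.

Let measurable_fun_sigma d' (V : measurableType d') J (f : sigma J -> V) :
  measurable_fun setT f -> measurable_fun setT (f : T -> V).
Proof.
by move=> mf; exact: (measurableT_comp mf (@measurable_sigma_id _ _ _ _ _ X J)).
Qed.

Let measurable_stackT k : measurable_seq (Q k : T -> seq R).
Proof.
have [sQ nQ] := measurable_stack (leqnn k).
by split=> [|i]; [exact: (measurable_fun_sigma sQ)|exact: (measurable_fun_sigma (nQ i))].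
Qed.

Let measurable_boundedT n k : measurable_fun setT (fun w : T => (bounded n k w)%:R : R).
Proof. exact: (measurable_fun_sigma (measurable_bounded n (leqnn k))). Qed.

Lemma measurable_set_bounded n k : measurable [set w : T | bounded n k w].
Proof.
rewrite (_ : [set w | _] = (fun w : T => (bounded n k w)%:R : R) @^-1` [set 1]).
  by rewrite -[X in measurable X]setTI; exact: measurable_boundedT.
by apply/seteqP; split=> w /=; case: bounded => // /eqP; rewrite eq_sym oner_eq0.
Qed.

Lemma rates_laplace_ge0 n i : 0 <= nth 0 (rates lam p laplace n) i.
Proof. exact: (rates_ge0 (ltW lam_gt0) p_ge0 sum_p_le1 _ _ laplace01). Qed.

(** * The stopped martingale and the lower bound *)

Section bounded_by.
Variable n : nat.
Local Notation th := (rates lam p laplace n).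
Local Notation g := (batch_value p laplace).

(** [value] is harmonic: averaging over the batch gives [arrival_value] of the drained stack, which
    [integral_drain_value] averages back to [value]. *)
Lemma integral_arrive_value q k : all (>= 0) q -> (size q <= n)%N ->
  (\int[P]_w1 \int[P]_w2 (value th (arrive q (A k w1) (batch k.+1 w2)))%:E =
   (value th q)%:E)%E.
Proof.
move=> q0 qn.
have th0 m i : 0 <= nth 0 (drop m th) i by rewrite nth_drop rates_laplace_ge0.
have g01 i : (i < size th)%N -> 0 <= g (drop i.+1 th) <= 1.
  move=> _; exact: (batch_value01 p_ge0 sum_p_le1 (th0 i.+1) laplace01).
have thE i : (i < size th)%N -> nth 0 th i = lam * (1 - g (drop i.+1 th)).
  by rewrite size_rates; exact: nth_rates.
have qth : (size q <= size th)%N by rewrite size_rates.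
rewrite -(integral_drain_value lam_gt0 (A_tail k) g01 thE q0 qth).
apply: eq_integral => w _; rewrite /arrive /arrival_value.
case: drain => [|r v].
  by rewrite integral_cst// mul1e; exact: (@probability_setT _ _ _ P).
under eq_integral do rewrite value_cat EFinM.
rewrite ge0_integralZr//.
- by rewrite integral_value_batch// EFinM.
- by apply/measurable_EFinP/measurable_value; exact: measurable_batchT.
- by move=> w' _; rewrite lee_fin value_ge0.
- by rewrite lee_fin value_ge0.
Qed.

(* The stopped value of the stack is a martingale. *)
Lemma integral_bounded_value k :
  (\int[P]_w ((bounded n k w)%:R * value th (Q k w))%:E = (g th)%:E)%E.
Proof.
(* [value] already vanishes above the capacity, so the newest indicator is absorbed. *)
have drop_size w k' : (size (Q k' w) <= n)%N%:R * value th (Q k' w) = value th (Q k' w).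
  have [_|nQ] := leqP; first by rewrite mul1r.
  by rewrite value_oversize ?mulr0// size_rates.
elim: k => [|k IH].
  rewrite -(integral_value_batch 0 (rates_laplace_ge0 n)).
  apply: eq_integral => w _; congr _%:E.
  rewrite -[bounded n 0 w]/((size (Q 0 w) <= n)%N && true) andbT.
  exact: drop_size.
rewrite -IH.
transitivity (\int[P]_w ((bounded n k w)%:R *
    value th (arrive (Q k w) (A k w) (batch k.+1 w)))%:E)%E.
  apply: eq_integral => w _.
  rewrite -[arrive (Q k w) _ _]/(Q k.+1 w).
  rewrite -[bounded n k.+1 w]/((size (Q k.+1 w) <= n)%N && bounded n k w).
  by rewrite -mulnb natrM mulrAC drop_size mulrC.
rewrite (@integral_next k (fun w => (bounded n k w)%:R)
  (fun q x u => value th (arrive q x u)))//; last 3 first.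
- exact: measurable_bounded.
- by move=> *; apply: measurable_value; exact: measurable_seq_arrive.
- by move=> *; exact: value_ge0.
apply: eq_integral => w _; case: (boolP (bounded n k w)) => [bw|_].
  by rewrite integral_arrive_value ?mul1e ?mul1r ?stack_ge0// bounded_size.
by rewrite mul0e mul0r.
Qed.

Lemma le_prob_bounded k : ((g th)%:E <= P [set w | bounded n k w])%E.
Proof.
rewrite -(integral_bounded_value k) -[X in P X]setIT -integral_indic//; last first.
  exact: measurable_set_bounded.
apply: ge0_le_integral => //.
- by move=> w _; rewrite lee_fin mulr_ge0// value_ge0.
- by apply/measurable_EFinP/measurable_funM => //; exact: measurable_value.
- apply/measurable_EFinP/measurable_indic; exact: measurable_set_bounded.
- move=> w _; rewrite lee_fin indicE; case: (boolP (bounded n k w)) => bw.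
    rewrite mem_set//= mul1r value_le1 ?stack_ge0// => i.
    exact: rates_laplace_ge0.
  by rewrite mul0r.
Qed.

Lemma bounded_forall :
  [set w | forall k, (size (Q k w) <= n)%N] = \bigcap_k [set w | bounded n k w].
Proof.
apply/seteqP; split=> w.
  by move=> /boundedP bw k _; exact: bw.
by move=> bw; apply/boundedP => k; exact: bw.
Qed.

Lemma measurable_bounded_forall : measurable [set w : T | forall k, (size (Q k w) <= n)%N].
Proof.
by rewrite bounded_forall; apply: bigcapT_measurable => k; exact: measurable_set_bounded.
Qed.

Lemma le_prob_bounded_forall :
  ((g th)%:E <= P [set w | forall k, (size (Q k w) <= n)%N])%E.
Proof.
have mB k := measurable_set_bounded n k.
have cB : P \o (fun k => [set w | bounded n k w]) @ \oo -->
    P (\bigcap_k [set w | bounded n k w]).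
  apply: nonincreasing_cvg_mu => //.
  - by rewrite (le_lt_trans (probability_le1 P (mB 0%N)))// ltry.
  - by apply: bigcapT_measurable => k; exact: mB.
  - by move=> k m km; apply/subsetPset => w /=; exact: bounded_decr.
rewrite bounded_forall -(cvg_lim _ cB)//; apply: lime_ge.
  by apply/cvg_ex; exists (P (\bigcap_k [set w | bounded n k w])).
by apply: nearW => k; exact: le_prob_bounded.
Qed.

(** * Stability, drift of the work and the upper bound *)

Variable mu : R.
Hypothesis p0 : p 0%N = 0.
Hypothesis p_mean : (fun N : nat => \sum_(m < N) m%:R * p m) @ \oo --> mu.
Hypothesis stable : ((lam * mu)%:E * 'E_P[S 0%N 0%N] < 1)%E.

Let ES := fine 'E_P[S 0%N 0%N]%E.

Lemma sum_mean_le m : \sum_(i < m) i%:R * p i <= mu.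
Proof.
have nd : nondecreasing_seq (fun n => \sum_(m < n) m%:R * p m).
  by apply/nondecreasing_seqP => k; rewrite big_ord_recr/= lerDl mulr_ge0.
rewrite -(cvg_lim _ p_mean)//; apply: nondecreasing_cvgn_le => //.
by apply/cvg_ex; exists mu.
Qed.

Lemma mean_batch_size_ge1 : 1 <= mu.
Proof.
have : \sum_(n < N) p n @[N --> \oo] --> (1 : R) by [].
move=> /cvg_lim <-//; apply: limr_le; first by apply/cvg_ex; exists 1.
apply: nearW => m; rewrite (le_trans _ (sum_mean_le m))// ler_sum// => -[[|i] im] _ /=.
  by rewrite p0 mulr0.
by rewrite ler_peMl// ler1n.
Qed.

(** Since [mu] is at least 1, an infinite mean service would contradict stability. *)
Lemma expectation_S : (\int[P]_w (S 0 0 w)%:E = ES%:E)%E.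
Proof.
have E0 : (0 <= 'E_P[S 0%N 0%N])%E by apply: expectation_ge0.
rewrite -[LHS]/(\int[P]_w (S 0 0 w)%:E)%E.
have EE : 'E_P[S 0%N 0%N]%E = (\int[P]_w (S 0 0 w)%:E)%E by rewrite unlock.
rewrite -EE fineK// ge0_fin_numE// ltNge leye_eq; apply/negP => /eqP Eoo.
move: stable; rewrite Eoo gt0_muley ?lte_fin// mulr_gt0//.
exact: lt_le_trans mean_batch_size_ge1.
Qed.

Lemma ES_ge0 : 0 <= ES.
Proof. by rewrite -lee_fin -expectation_S integral_ge0// => w _; rewrite lee_fin. Qed.

Let slack := lam^-1 - mu * ES.

Lemma slack_gt0 : 0 < slack.
Proof.
rewrite subr_gt0 -(ltr_pM2l lam_gt0) divff ?gt_eqF// mulrA -lte_fin EFinM.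
rewrite -expectation_S; move: stable.
by rewrite unlock.
Qed.

Lemma sum_batch k w : \sum_(r <- batch k w) r = \sum_(j < N k w) S k j w.
Proof.
rewrite /batch /batch_stack (perm_big [seq S k j w | j <- iota 0 (N k w)]).
  by rewrite big_map -{1}(subn0 (N k w)) big_mkord.
by rewrite perm_rev.
Qed.

Lemma integral_batch_service k m j : (j < m)%N ->
  (\int[P]_w ((N k w == m)%:R * S k j w)%:E = (p m * ES)%:E)%E.
Proof.
(* [integral_batch_prod] wants [phi] nonnegative on all of [R]; the maximum with 0 does not affect
   the services. *)
move=> jm; pose phi i (x : R) : R := if i == j then Num.max 0 x else 1.
pose e i : R := if i == j then ES else 1.
have prod_e : \prod_(i < j.+1) e i = ES.
  rewrite big_ord_recr/= {2}/e eqxx big1 ?mul1r// => i _.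
  by rewrite /e ltn_eqF.
rewrite -prod_e -(@integral_batch_prod k m j.+1 phi e).
- apply: eq_integral => w _; rewrite big_ord_recr/= {2}/phi eqxx max_r// big1 ?mul1r// => i _.
  by rewrite /phi ltn_eqF.
- move=> i; rewrite /phi; case: (i == j); last exact: measurable_cst.
  by apply: measurable_maxr => //; exact: measurable_cst.
- by move=> i x; rewrite /phi; case: ifP => // _; rewrite le_max lexx.
- move=> i; rewrite /phi /e; case: (i == j).
    by rewrite -expectation_S; apply: eq_integral => w _; rewrite max_r.
  by rewrite integral_cst// mul1e; exact: (@probability_setT _ _ _ P).
Qed.

(** A Wald identity truncated at [n]: batches of size [m] contribute [m%:R * p m * ES]. *)
Lemma integral_sum_batch_le k :
  (\int[P]_w ((size (batch k w) <= n)%N%:R * \sum_(r <- batch k w) r)%:E <=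
   (mu * ES)%:E)%E.
Proof.
have sE w : (size (batch k w) <= n)%N%:R * \sum_(r <- batch k w) r =
    \sum_(m < n.+1) \sum_(j < m) (N k w == m)%:R * S k j w.
  rewrite sum_batch /batch /batch_stack size_rev size_map size_iota.
  transitivity (\sum_(m < n.+1) (N k w == m)%:R * \sum_(j < m) S k j w); last first.
    by apply: eq_bigr => m _; rewrite mulr_sumr.
  have [Nn|Nn] := leqP (N k w) n.
    rewrite (bigD1 (Ordinal (Nn : (N k w < n.+1)%N)))//= eqxx.
    rewrite [X in _ = _ + X]big1 ?addr0// => i.
    by rewrite -val_eqE /= eq_sym => /negbTE ->; rewrite mul0r.
  rewrite mul0r big1// => i _.
  by rewrite gtn_eqF ?mul0r// (leq_trans (ltn_ord i)).
have mNS m j : measurable_fun setT (fun w => (N k w == m)%:R * S k j w).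
  apply: measurable_funM; last exact: measurable_funP.
  by apply: (@measurable_fun_nat_comp _ T _ R (N k) (fun n _ => (n == m)%:R)).
have NS0 m j w : 0 <= (N k w == m)%:R * S k j w by rewrite mulr_ge0.
under eq_integral do rewrite sE -sumEFin.
rewrite ge0_integral_sum//; last 2 first.
- by move=> m; apply/measurable_EFinP/measurable_sum.
- by move=> m w _; rewrite lee_fin sumr_ge0.
rewrite (eq_bigr (fun m : 'I_n.+1 => (m%:R * p m * ES)%:E)) => [|m _].
  by rewrite sumEFin lee_fin -mulr_suml ler_wpM2r ?ES_ge0// sum_mean_le.
under eq_integral do rewrite -sumEFin.
rewrite ge0_integral_sum//; last 2 first.
- by move=> j; apply/measurable_EFinP.
- by move=> j w _; rewrite lee_fin.
rewrite (eq_bigr (fun=> (p m * ES)%:E)) => [|j _]; last exact: integral_batch_service.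
by rewrite sumEFin sumr_const card_ord -mulrA mulr_natl.
Qed.

(* The bonus [slack] makes the expected drift of the work at most zero. *)
Let drift q x u : R := (drain q x != [::])%:R *
  ((size (arrive q x u) <= n)%N%:R * \sum_(r <- arrive q x u) r + slack).

Lemma drift_ge0 q x u : all (>= 0) q -> all (>= 0) u -> 0 <= drift q x u.
Proof.
move=> q0 u0; rewrite mulr_ge0// addr_ge0 ?(ltW slack_gt0)// mulr_ge0//.
by rewrite sum_seq_ge0// arrive_ge0.
Qed.

Lemma measurable_size_le d' (U : measurableType d') (f : U -> seq R) : measurable_seq f ->
  measurable_fun setT (fun w => (size (f w) <= n)%N%:R : R).
Proof.
move=> [sf _]; exact: (@measurable_fun_nat_comp _ U _ R _ (fun s _ => (s <= n)%N%:R) sf).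
Qed.

Lemma measurable_drain_neq_nil d' (U : measurableType d') (f : U -> seq R) x :
  measurable_seq f -> measurable_fun setT x ->
  measurable_fun setT (fun w => (drain (f w) (x w) != [::])%:R : R).
Proof.
move=> mf mx; have [sf _] := measurable_seq_drain mf mx.
rewrite (_ : (fun w => _) = fun w => (size (drain (f w) (x w)) != 0%N)%:R).
  exact: (@measurable_fun_nat_comp _ U _ R _ (fun s _ => (s != 0%N)%:R) sf).
by apply/funext => w; case: drain.
Qed.

Lemma measurable_drift d' (U : measurableType d') f x g : measurable_seq f ->
  measurable_fun setT x -> measurable_seq g ->
  measurable_fun setT (fun w : U => drift (f w) (x w) (g w)).
Proof.
move=> mf mx mg; have ma := measurable_seq_arrive mf mx mg.
apply: measurable_funM; first exact: measurable_drain_neq_nil.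
apply: measurable_funD; last exact: measurable_cst.
apply: measurable_funM; first exact: measurable_size_le.
exact: measurable_sum_seq.
Qed.

(** A batch adds at most [mu * ES] on average; with [slack] this makes [lam^-1], the bonus in
    [integral_drain_sum]. *)
Lemma integral_drift_le q k : all (>= 0) q ->
  (\int[P]_w1 \int[P]_w2 (drift q (A k w1) (batch k.+1 w2))%:E <=
   (\sum_(r <- q) r)%:E)%E.
Proof.
move=> q0; rewrite -(integral_drain_sum lam_gt0 (A_tail k) q0).
have inner x : (\int[P]_w2 (drift q x (batch k.+1 w2))%:E <=
    (sum_if_nonempty lam^-1 (drain q x))%:E)%E.
  rewrite /drift /arrive; have := drain_ge0 x q0.
  case: (drain q x) => [_|r v rv0].
    by rewrite integral0_eq// => w _; rewrite mul0r.
  rewrite /sum_if_nonempty; set s := \sum_(_ <- _) _.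
  have s0 : 0 <= s by exact: sum_seq_ge0.
  pose bs w := (size (batch k.+1 w) <= n)%N%:R * \sum_(r <- batch k.+1 w) r.
  have bs0 w : 0 <= bs w by rewrite mulr_ge0// sum_seq_ge0// batch_ge0.
  have mbs : measurable_fun setT bs.
    apply: measurable_funM; first exact/measurable_size_le/measurable_batchT.
    exact/measurable_sum_seq/measurable_batchT.
  have sl0 : 0 <= s + slack by rewrite addr_ge0// ltW// slack_gt0.
  apply: (@le_trans _ _ (\int[P]_w ((bs w)%:E + (s + slack)%:E))%E).
    apply: ge0_le_integral => //.
    - move=> w _; rewrite lee_fin mul1r addr_ge0 ?(ltW slack_gt0)// mulr_ge0//.
      by rewrite big_cat addr_ge0 ?sum_seq_ge0// batch_ge0.
    - apply/measurable_EFinP; under eq_fun do rewrite mul1r.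
      have mb : measurable_seq (fun w => batch k.+1 w ++ r :: v).
        apply: measurable_seq_cat; [exact: measurable_batchT|exact: measurable_seq_cst].
      apply: measurable_funD; last exact: measurable_cst.
      by apply: measurable_funM; [exact: measurable_size_le|exact: measurable_sum_seq].
    - by apply/measurable_EFinP/measurable_funD => //; exact: measurable_cst.
    - move=> w _; rewrite -EFinD lee_fin mul1r (addrA (bs w)) lerD2r big_cat -/s /bs.
      have b0 := sum_seq_ge0 (batch_ge0 k.+1 w).
      (* If the whole stack fits, so does the batch alone. *)
      case: (leqP (size (batch k.+1 w ++ r :: v)) n) => [sn|_].
        rewrite mul1r lerD2r (leq_trans _ sn) ?mul1r//.
        by rewrite size_cat leq_addr.
      by rewrite mul0r addr_ge0// mulr_ge0.
  rewrite ge0_integralD//; last 2 first.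
  - by move=> w _; rewrite lee_fin.
  - exact/measurable_EFinP.
  rewrite integral_cst// [X in (_ + _ * X)%E](_ : _ = 1%E); last first.
    exact: (@probability_setT _ _ _ P).
  rewrite mule1 (@le_trans _ _ ((mu * ES)%:E + (s + slack)%:E)%E)//.
    by rewrite leeD2r// integral_sum_batch_le.
  by rewrite -EFinD lee_fin /slack addrCA subrKC.
apply: ge0_le_integral => //.
- move=> w _; apply: integral_ge0 => w' _; rewrite lee_fin drift_ge0//.
  exact: batch_ge0.
- pose f (z : T * T) := (drift q (A k z.1) (batch k.+1 z.2))%:E.
  apply: (@measurable_fun_fubini_tonelli_F _ _ T T R P f).
    apply/measurable_EFinP/measurable_drift; first exact: measurable_seq_cst.
      exact: (measurableT_comp (measurable_funP (A k)) measurable_fst).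
    have [sb nb] := measurable_batchT k.+1; split=> [|i].
      exact: (measurableT_comp sb measurable_snd).
    exact: (measurableT_comp (nb i) measurable_snd).
  by move=> z; rewrite lee_fin drift_ge0// batch_ge0.
- apply/measurable_EFinP/measurable_sum_if_nonempty/measurable_seq_drain.
    exact: measurable_seq_cst.
  exact: measurable_funP.
Qed.

Let load k w : R := (bounded n k w)%:R * \sum_(r <- Q k w) r.
Let alive k w : R := (bounded n k w)%:R * (drain (Q k w) (A k w) != [::])%:R.

Let load_ge0 k w : 0 <= load k w.
Proof. by rewrite mulr_ge0// sum_seq_ge0// stack_ge0. Qed.

Let alive_ge0 k w : 0 <= alive k w.
Proof. by rewrite mulr_ge0. Qed.

Let measurable_load k : measurable_fun setT (load k).
Proof.
by apply: measurable_funM; [exact: measurable_boundedT|exact: measurable_sum_seq].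
Qed.

Let measurable_alive k : measurable_fun setT (alive k).
Proof.
apply: measurable_funM; first exact: measurable_boundedT.
by apply: measurable_drain_neq_nil => //; exact: measurable_funP.
Qed.

(** The Lyapunov inequality: each arrival finding a busy period neither ended nor failed costs
    [slack] of mean work. *)
Lemma load_step k :
  (\int[P]_w (load k.+1 w)%:E + slack%:E * \int[P]_w (alive k w)%:E <=
   \int[P]_w (load k w)%:E)%E.
Proof.
rewrite -ge0_integralZl_EFin ?(ltW slack_gt0)//; last 2 first.
- by move=> w _; rewrite lee_fin.
- exact/measurable_EFinP.
rewrite -ge0_integralD//; last 4 first.
- by move=> w _; rewrite lee_fin.
- exact/measurable_EFinP.
- by move=> w _; rewrite -EFinM lee_fin mulr_ge0// ltW// slack_gt0.
- apply/measurable_EFinP/measurable_funM => //; exact: measurable_cst.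
rewrite (eq_integral (fun w => ((bounded n k w)%:R *
    drift (Q k w) (A k w) (batch k.+1 w))%:E)); last first.
  move=> w _; rewrite -EFinM -EFinD; congr _%:E.
  rewrite /load /alive -[bounded n k.+1 w]/((size (Q k.+1 w) <= n)%N && bounded n k w).
  rewrite /drift -[arrive (Q k w) _ _]/(Q k.+1 w) -mulnb natrM.
  have [d0|_] := eqVneq (drain (Q k w) (A k w)) [::]; last first.
    by rewrite mul1r mulr1 mulrDr mulrA (mulrC (bounded _ _ _)%:R (_ <= _)%N%:R) (mulrC slack).
  by rewrite (_ : Q k.+1 w = [::]) ?big_nil ?mulr0 ?mul0r ?mulr0 ?addr0// /Q/= /arrive d0.
rewrite (@integral_next k (fun w => (bounded n k w)%:R) drift)//; last 3 first.
- exact: measurable_bounded.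
- by move=> *; exact: measurable_drift.
- by move=> *; exact: drift_ge0.
rewrite [leRHS](eq_integral (fun w => (bounded n k w)%:R%:E * (\sum_(r <- Q k w) r)%:E)%E); last first.
  by move=> w _; rewrite EFinM.
apply: ge0_le_integral => //.
- move=> w _; rewrite mule_ge0 ?lee_fin//; apply: integral_ge0 => w1 _.
  by apply: integral_ge0 => w2 _; rewrite lee_fin drift_ge0 ?stack_ge0 ?batch_ge0.
- apply: emeasurable_funM; first exact/measurable_EFinP.
  pose f (z : T * T) := (\int[P]_w2 (drift (Q k z.1) (A k z.2) (batch k.+1 w2))%:E)%E.
  have f0 z : (0 <= f z)%E.
    by apply: integral_ge0 => w2 _; rewrite lee_fin drift_ge0 ?stack_ge0 ?batch_ge0.
  apply: (@measurable_fun_fubini_tonelli_F _ _ T T R P f) => //.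
  pose h (z : (T * T) * T) := (drift (Q k z.1.1) (A k z.1.2) (batch k.+1 z.2))%:E.
  apply: (@measurable_fun_fubini_tonelli_F _ _ (T * T)%type T R P h).
    apply/measurable_EFinP/measurable_drift.
    - have [sb nb] := measurable_stackT k; split=> [|i].
        exact: (measurableT_comp (measurableT_comp sb measurable_fst) measurable_fst).
      exact: (measurableT_comp (measurableT_comp (nb i) measurable_fst) measurable_fst).
    - exact: (measurableT_comp (measurableT_comp (measurable_funP (A k)) measurable_snd) measurable_fst).
    - have [sb nb] := measurable_batchT k.+1; split=> [|i].
        exact: (measurableT_comp sb measurable_snd).
      exact: (measurableT_comp (nb i) measurable_snd).
  by move=> z; rewrite lee_fin drift_ge0 ?stack_ge0 ?batch_ge0.
- apply: emeasurable_funM; first exact/measurable_EFinP.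
  exact/measurable_EFinP/measurable_sum_seq.
- move=> w _; rewrite lee_wpmul2l ?lee_fin//.
  by rewrite integral_drift_le// stack_ge0.
Qed.

(** [load_step] telescopes, starting from the mean work of one truncated batch. *)
Lemma sum_alive_le k :
  (\int[P]_w (load k w)%:E + slack%:E * \sum_(i < k) \int[P]_w (alive i w)%:E <=
   (mu * ES)%:E)%E.
Proof.
have a0 i : (0 <= \int[P]_w (alive i w)%:E)%E.
  by apply: integral_ge0 => w _; rewrite lee_fin.
elim: k => [|k IH].
  rewrite big_ord0 mule0 adde0; apply: le_trans (integral_sum_batch_le 0).
  rewrite le_eqVlt; apply/orP; left; apply/eqP; apply: eq_integral => w _; congr _%:E.
  by rewrite /load -[bounded n 0 w]/((size (Q 0 w) <= n)%N && true) andbT.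
apply: le_trans IH; rewrite big_ord_recr/= addeC ge0_muleDr ?sume_ge0//.
rewrite -addeA addeC [X in (X + _ <= _)%E]addeC leeD2r//; exact: load_step.
Qed.

Lemma alive_small (eps : R) : 0 < eps ->
  exists k, (\int[P]_w (alive k w)%:E < eps%:E)%E.
Proof.
move=> eps0; apply: contrapT => /forallNP alive_ge.
have {}alive_ge k : (eps%:E <= \int[P]_w (alive k w)%:E)%E.
  by rewrite leNgt; apply/negP; exact: alive_ge.
(* With [m] terms of size at least [eps], the sum times [slack] would exceed [mu * ES]. *)
pose m := (Num.truncn (mu * ES / (slack * eps))).+1.
have : ((slack * (m%:R * eps))%:E <= (mu * ES)%:E)%E.
  apply: le_trans (sum_alive_le m).
  rewrite -[leLHS]add0e leeD//.
    by apply: integral_ge0 => w _; rewrite lee_fin.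
  rewrite EFinM lee_wpmul2l ?lee_fin ?(ltW slack_gt0)//.
  apply: (@le_trans _ _ (\sum_(i < m) eps%:E)%E); last exact: lee_sum.
  by rewrite sumEFin lee_fin sumr_const card_ord mulr_natl.
rewrite lee_fin mulrCA -ler_pdivlMr ?mulr_gt0 ?slack_gt0//.
by rewrite leNgt truncnS_gt.
Qed.

(** A path within the capacity at [k.+1] either was [alive] at [k], which is unlikely for a
    well-chosen [k], or has an empty stack, of value 1. So its indicator is at most the stopped
    value plus [alive]. *)
Lemma prob_bounded_forall_le :
  (P [set w | forall k, (size (Q k w) <= n)%N] <=
   (batch_value p laplace (rates lam p laplace n))%:E)%E.
Proof.
apply/lee_addgt0Pr => eps eps0; have [k pik] := alive_small eps0.
apply: (@le_trans _ _ (P [set w | bounded n k.+1 w])).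
  apply: le_measure; rewrite ?inE.
  - exact: measurable_bounded_forall.
  - exact: measurable_set_bounded.
  - by move=> w /boundedP; exact.
rewrite -(integral_bounded_value k.+1) -[X in P X]setIT -integral_indic//; last first.
  exact: measurable_set_bounded.
apply: (@le_trans _ _ (\int[P]_w (((bounded n k.+1 w)%:R * value th (Q k.+1 w))%:E +
    (alive k w)%:E))%E).
  apply: ge0_le_integral => //.
  - apply/measurable_EFinP/measurable_indic; exact: measurable_set_bounded.
  - apply/measurable_EFinP/measurable_funD => //.
    apply: measurable_funM; first exact: measurable_boundedT.
    exact: measurable_value.
  - move=> w _; rewrite -EFinD lee_fin indicE /alive.
    case: (boolP (bounded n k.+1 w)) => bw; last first.
      rewrite memNset; last exact/negP.
      by rewrite addr_ge0// mulr_ge0// value_ge0.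
    rewrite mem_set// mul1r.
    rewrite (bounded_decr (leqnSn k) bw) mul1r.
    have [d0|_] := eqVneq (drain (Q k w) (A k w)) [::].
      by rewrite (_ : Q k.+1 w = [::]) ?addr0// /Q/= /arrive d0.
    by rewrite lerDr value_ge0.
rewrite ge0_integralD//; last 4 first.
- by move=> w _; rewrite lee_fin mulr_ge0// value_ge0.
- apply/measurable_EFinP/measurable_funM; first exact: measurable_boundedT.
  exact: measurable_value.
- by move=> w _; rewrite lee_fin.
- exact/measurable_EFinP.
by rewrite leeD2l// ltW.
Qed.

End bounded_by.

End queue.

(** * Reduction to nonnegative service times *)

Section absolute_services.
Context d (T : measurableType d) (R : realType) (P : probability T R).
Variables (lam : R) (p : nat -> R).
Variables (A B : nat -> {RV P >-> R}) (S : nat -> nat -> {RV P >-> R}).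
Hypothesis inputs : MX_G_1_inputs P lam p A B S.

Let measurable_abs k j : measurable_fun setT (fun w => `|S k j w|).
Proof. by apply: measurableT_comp => //; exact: measurable_funP. Qed.

(** The inputs make services nonnegative only almost surely, while the analysis above asks for it
    everywhere. *)
Definition abs_service k j : {RV P >-> R} :=
  HB.pack_for {mfun T >-> R} (fun w => `|S k j w|)
    (isMeasurableFun.Build _ _ T R _ (measurable_abs k j)).

Lemma abs_inputs : MX_G_1_inputs P lam p A B abs_service.
Proof.
have [indep A_tail B_law S_id _] := inputs.
have mabs (E : set R) : measurable E -> measurable ((fun x : R => `|x|) @^-1` E).
  have mnorm : measurable_fun setT (fun x : R => `|x|) by [].
  by move=> mE; rewrite -[X in measurable X]setTI; exact: mnorm.
split=> //.
- move=> J E mE nJ.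
  pose E' i := if i is IS _ _ then (fun x : R => `|x|) @^-1` E i else E i.
  have mE' i : List.In i J -> measurable (E' i).
    by case: i => [i|i|i j] iJ; [exact: mE|exact: mE|exact: (mabs _ (mE _ iJ))].
  apply: etrans (etrans (indep J E' mE' nJ) _).
    by congr (P _); apply: eq_bigcapr => -[i|i|i j] _.
  by apply: eq_bigr => -[i|i|i j] _.
- by move=> k j E mE; exact: (S_id k j _ (mabs E mE)).
- rewrite (_ : [set w | _] = set0) ?measure0// -subset0 => w /=.
  by rewrite ltNge normr_ge0.
Qed.

Lemma service_ge0_ae : {ae P, forall w, forall k j, 0 <= S k j w}.
Proof.
have [_ _ _ S_id S0] := inputs.
apply: ae_foralln => k; apply: ae_foralln => j.
exists [set w | S k j w < 0]; split.
- rewrite (_ : [set w | _] = S k j @^-1` `]-oo, 0[).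
    by rewrite -[X in measurable X]setTI; exact: measurable_funP.
  by apply/seteqP; split=> w /=; rewrite in_itv.
- have := S_id k j `]-oo, 0[%classic (measurable_itv _).
  have preE i l : S i l @^-1` `]-oo, 0[ = [set w | S i l w < 0].
    by apply/seteqP; split=> w /=; rewrite in_itv.
  by rewrite !preE S0.
- by move=> w /= /negP; rewrite -ltNge.
Qed.

Lemma abs_service_ae :
  {ae P, forall w, (fun k j => abs_service k j w) = (fun k j => S k j w)}.
Proof.
apply: filterS service_ge0_ae => w S0.
by apply/funext => k; apply/funext => j; rewrite /abs_service/= ger0_norm.
Qed.

Lemma integral_abs_service (phi : R -> R) : measurable_fun setT phi ->
  (\int[P]_w (phi (abs_service 0 0 w))%:E = \int[P]_w (phi (S 0%N 0%N w))%:E)%E.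
Proof.
move=> mphi; apply: ae_eq_integral => //.
- apply/measurable_EFinP/measurableT_comp => //; exact: measurable_funP.
- apply/measurable_EFinP/measurableT_comp => //; exact: measurable_funP.
- apply: filterS abs_service_ae => w Sw _.
  by rewrite -[abs_service 0 0 w]/((fun k j => abs_service k j w) 0%N 0%N) Sw.
Qed.

End absolute_services.

(** * The tail of the maximum in terms of stacks *)

Section max_busy.
Context d (T : measurableType d) (R : realType) (P : probability T R).
Implicit Types (A B : nat -> {RV P >-> R}) (S : nat -> nat -> {RV P >-> R}).

Local Notation stack A B S k w :=
  (stack_at (fun i => A i w) (fun i => Num.truncn (B i w)) (fun i j => S i j w) k).

(** Sizes are integers, so exceeding [t] means exceeding its integer part. *)
Lemma max_busy_le_truncn A B S (t : R) : 0 <= t ->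
  [set w | (t%:E < max_busy A B S w)%E] =
  ~` [set w | forall k, (size (stack A B S k w) <= Num.truncn t)%N].
Proof.
move=> t0; apply/seteqP; split=> w /=.
  move=> /lt_lcfs_max_busy[k tk] sk; have := sk k; rewrite leqNgt => /negP; apply.
  by rewrite truncn_lt_nat.
move=> /existsNP[k /negP]; rewrite -ltnNge truncn_lt_nat// => tk.
by apply/lt_lcfs_max_busy; exists k.
Qed.

Lemma measurable_stack_le A B S n :
  measurable [set w | forall k, (size (stack A B S k w) <= n)%N].
Proof.
rewrite (_ : [set w | _] = \bigcap_k ((fun w => size (stack A B S k w)) @^-1`
    [set m | (m <= n)%N])); last by apply/seteqP; split=> w /= h k; [move=> _|]; exact: h.
apply: bigcapT_measurable => k; rewrite -[X in measurable X]setTI.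
have [ms _] : measurable_seq (fun w => stack A B S k w).
  apply: (@measurable_stack_at _ T R A (fun i w => Num.truncn (B i w)) S) => [i _|i _|i j _].
  - exact: measurable_funP.
  - exact/measurable_truncn/measurable_funP.
  - exact: measurable_funP.
exact: ms.
Qed.

Lemma measurable_max_busy A B S (t : R) : 0 <= t ->
  measurable [set w | (t%:E < max_busy A B S w)%E].
Proof.
by move=> t0; rewrite max_busy_le_truncn//; apply: measurableC; exact: measurable_stack_le.
Qed.

Lemma prob_max_busy_neg A B S (t : R) : t < 0 ->
  P [set w | (t%:E < max_busy A B S w)%E] = 1%E.
Proof.
move=> t0; rewrite (_ : [set w | _] = setT) ?probability_setT//.
apply/seteqP; split=> // w _; apply/lt_lcfs_max_busy; exists 0%N.
exact: lt_le_trans t0 (ler0n _ _).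
Qed.

Lemma prob_max_busy_abs lam p A B S (t : R) : 0 <= t -> MX_G_1_inputs P lam p A B S ->
  P [set w | (t%:E < max_busy A B S w)%E] =
  P [set w | (t%:E < max_busy A B (abs_service S) w)%E].
Proof.
move=> t0 inputs.
set E := [set w | _]; set E' := [set w | _].
have mE : measurable E by exact: measurable_max_busy.
have mE' : measurable E' by exact: measurable_max_busy.
rewrite -[E]setIT -[E']setIT -!integral_indic//.
apply: ae_eq_integral => //.
- exact/measurable_EFinP/measurable_indic.
- exact/measurable_EFinP/measurable_indic.
- apply: filterS (abs_service_ae inputs) => w Sw _.
  by congr _%:E; rewrite !indicE; congr (nat_of_bool _)%:R; apply/idP/idP;
    rewrite !inE /E /E' /= /max_busy Sw.
Qed.

End max_busy.

(** * Comparison *)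

Section comparison.
Context (R : realType) (lam mu : R) (p : nat -> R).
Context d (T : measurableType d) (P : probability T R).
Variables (A B : nat -> {RV P >-> R}) (S : nat -> nat -> {RV P >-> R}).
Context d' (T' : measurableType d') (P' : probability T' R).
Variables (A' B' : nat -> {RV P' >-> R}) (S' : nat -> nat -> {RV P' >-> R}).
Hypothesis lam_gt0 : 0 < lam.
Hypothesis p0 : p 0%N = 0.
Hypothesis p_ge0 : forall n, 0 <= p n.
Hypothesis p_sum : (fun N : nat => \sum_(n < N) p n) @ \oo --> (1 : R).
Hypothesis p_mean : (fun N : nat => \sum_(n < N) n%:R * p n) @ \oo --> mu.
Hypothesis inputs : MX_G_1_inputs P lam p A B S.
Hypothesis inputs' : MX_G_1_inputs P' lam p A' B' S'.
Hypothesis stable : ((lam * mu)%:E * 'E_P[S 0%N 0%N] < 1)%E.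

(** On complements, the chain is P(M <= n) <= g_0 <= g'_0 <= P'(M' <= n): upper bound, monotonicity
    in the transform, lower bound. *)
Lemma max_busy_le_nonneg (t : R) :
  (forall k j w, 0 <= S k j w) -> (forall k j w, 0 <= S' k j w) ->
  (forall theta : R, 0 < theta ->
    (\int[P]_w (expR (- (theta * S 0 0 w)))%:E <=
     \int[P']_w (expR (- (theta * S' 0 0 w)))%:E)%E) ->
  0 <= t ->
  (P' [set w | (t%:E < max_busy A' B' S' w)%E] <=
   P [set w | (t%:E < max_busy A B S w)%E])%E.
Proof.
move=> S0 S'0 LT t0; rewrite !max_busy_le_truncn//.
set n := Num.truncn t.
have mQ := measurable_stack_le A B S n.
have mQ' := measurable_stack_le A' B' S' n.
rewrite !probability_setC// leeB//.
apply: le_trans (prob_bounded_forall_le lam_gt0 p_ge0 p_sum inputs S0 n p0 p_mean stable) _.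
apply: le_trans _ (le_prob_bounded_forall lam_gt0 p_ge0 p_sum inputs' S'0 n).
rewrite lee_fin; apply: batch_value_rates_le => //.
- exact: ltW.
- exact: (sum_p_le1 p_ge0 p_sum).
- exact: laplace01.
- exact: laplace01.
- move=> x y /andP[y0 yx]; apply: (@le_trans _ _ (laplace S' x)); last first.
    by apply: laplace_anti => //; rewrite y0.
  have x0 := le_trans y0 yx.
  rewrite -lee_fin -!laplaceE//.
  (* The hypothesis [LT] covers positive arguments; at 0 both transforms are 1. *)
  move: x0; rewrite le_eqVlt => /predU1P[<-|]; last exact: LT.
  under eq_integral do rewrite mul0r oppr0 expR0.
  under [leRHS]eq_integral do rewrite mul0r oppr0 expR0.
  have PT : (P setT <= P' setT)%E by rewrite !probability_setT.
  by rewrite !integral_cst// !mul1e; exact: PT.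
Qed.

End comparison.

Theorem theorem2 (R : realType) (lam mu : R) (p : nat -> R)
  (d : measure_display) (T : measurableType d) (P : probability T R)
  (A : nat -> {RV P >-> R}) (B : nat -> {RV P >-> R})
  (S : nat -> nat -> {RV P >-> R})
  (d' : measure_display) (T' : measurableType d') (P' : probability T' R)
  (A' : nat -> {RV P' >-> R}) (B' : nat -> {RV P' >-> R})
  (S' : nat -> nat -> {RV P' >-> R}) :
  0 < lam ->
  (* batch-size distribution: on positive integers, with mean mu *)
  p 0%N = 0 -> (forall n, 0 <= p n) ->
  (fun N : nat => \sum_(n < N) p n) @ \oo --> (1 : R) ->
  (fun N : nat => \sum_(n < N) n%:R * p n) @ \oo --> mu ->
  MX_G_1_inputs P lam p A B S ->
  MX_G_1_inputs P' lam p A' B' S' ->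
  (* stability *)
  ((lam * mu)%:E * 'E_P[S 0%N 0%N] < 1)%E ->
  ((lam * mu)%:E * 'E_P'[S' 0%N 0%N] < 1)%E ->
  (* S' <=_LT S implies M' <=_st M *)
  ((forall theta : R, 0 < theta ->
      ('E_P[fun w => expR (- (theta * S 0%N 0%N w))] <=
       'E_P'[fun w => expR (- (theta * S' 0%N 0%N w))])%E) ->
   forall t : R, (P' [set w | (t%:E < max_busy A' B' S' w)%E] <=
                  P [set w | (t%:E < max_busy A B S w)%E])%E)
  /\
  (* in particular, S' >=_cx S implies M' <=_st M *)
  ((forall phi : R -> R, convex_fun phi ->
      P.-integrable setT (fun w => (phi (S 0%N 0%N w))%:E) ->
      P'.-integrable setT (fun w => (phi (S' 0%N 0%N w))%:E) ->
      ('E_P[fun w => phi (S 0%N 0%N w)] <= 'E_P'[fun w => phi (S' 0%N 0%N w)])%E) ->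
   forall t : R, (P' [set w | (t%:E < max_busy A' B' S' w)%E] <=
                  P [set w | (t%:E < max_busy A B S w)%E])%E).

Proof.
move=> lam0 p0 p_ge0 p_sum p_mean inputs inputs' stable _.
have measurable_expN theta : measurable_fun setT (fun x : R => expR (- (theta * x))).
  apply: (measurableT_comp (f := expR)) => //.
  under eq_fun do rewrite -mulNr.
  by apply: measurable_funM => //; exact: measurable_cst.
have LT_case : (forall theta : R, 0 < theta ->
      ('E_P[fun w => expR (- (theta * S 0%N 0%N w))] <=
       'E_P'[fun w => expR (- (theta * S' 0%N 0%N w))])%E) ->
   forall t : R, (P' [set w | (t%:E < max_busy A' B' S' w)%E] <=
                  P [set w | (t%:E < max_busy A B S w)%E])%E.
  move=> LT t; have [t0|t0] := ltP t 0; first by rewrite !prob_max_busy_neg.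
  rewrite (prob_max_busy_abs t0 inputs) (prob_max_busy_abs t0 inputs').
  apply: (max_busy_le_nonneg lam0 p0 p_ge0 p_sum p_mean (abs_inputs inputs)
    (abs_inputs inputs')) => //.
  - move: stable; rewrite unlock.
    by rewrite -(integral_abs_service inputs (phi := id)).
  - by move=> k j w; exact: normr_ge0.
  - by move=> k j w; exact: normr_ge0.
  - move=> theta theta0; have := LT theta theta0; rewrite unlock.
    rewrite -(integral_abs_service inputs (measurable_expN theta)).
    by rewrite -(integral_abs_service inputs' (measurable_expN theta)).
(* The maps [expR (- (theta * x))] are convex, and integrable because services are almost surely
   nonnegative, so they are admissible test functions. *)
split=> // cx; apply: LT_case => theta theta0.
have integrable_exp d0 (T0 : measurableType d0) (P0 : probability T0 R) A0 B0 S0 :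
    MX_G_1_inputs P0 lam p A0 B0 S0 ->
    P0.-integrable setT (fun w => (expR (- (theta * S0 0%N 0%N w)))%:E).
  move=> inputs0; apply/integrableP; split.
    apply/measurable_EFinP/(measurableT_comp (measurable_expN theta)).
    exact: measurable_funP.
  under eq_integral do rewrite gee0_abs ?lee_fin ?expR_ge0//.
  rewrite -(integral_abs_service inputs0 (measurable_expN theta)).
  apply: le_lt_trans (ltry 1).
  by apply: integral_expS_le1 => [k j w|]; [exact: normr_ge0|exact: ltW].
apply: (cx (fun x => expR (- (theta * x)))).
- move=> x y t t01; pose ti : {i01 R} := Itv01 (proj1 (andP t01)) (proj2 (andP t01)).
  have := convex_expR ti (- (theta * x)) (- (theta * y)).
  rewrite !convRE/= (_ : - (theta * (t * x + (1 - t) * y)) =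
    t * - (theta * x) + (1 - t) * - (theta * y)); last by ring.
  exact.
- exact: integrable_exp inputs.
- exact: integrable_exp inputs'.
Qed.
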